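(* For every fixed integer $d\ge 1$, the \textsc{$k$-Dominating Set} problem, parameterized by $k$ and restricted to $d$-degenerate input graphs, has a kernel with $O\big((d+2)^{2(d+2)}\cdot k^{2(d+1)^{2}}\big)$ vertices and edges, and this kernel can be computed in $O(2^{d}\cdot d\, n^{2})$ time for an input graph on $n$ vertices.
   Context: All graphs are finite, simple and undirected. A graph $G$ is $d$-degenerate if every subgraph of $G$ has a vertex of degree at most $d$. A dominating set of a graph $G=(V,E)$ is a set $S\subseteq V$ such that every vertex of $V\setminus S$ is adjacent to some vertex of $S$. The \textsc{$k$-Dominating Set} problem: given a graph $G$ and a positive integer $k$, decide whether $G$ has a dominating set of size at most $k$; the parameter is $k$. A kernel is an algorithm that, given $(G,k)$, outputs an instance $(G',k')$ such that the size of $G'$ is bounded by a function of $k$ alone (for fixed $d$), $k'$ is bounded by a function of $k$, and $G$ has a dominating set of size at most $k$ if and only if $G'$ has a dominating set of size at most $k'$. *)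

(* Defs.v *)
From mathcomp Require Import all_boot.

Set Implicit Arguments.
Unset Strict Implicit.
Unset Printing Implicit Defensive.

Record graph (n : nat) := Graph {
  adj : rel 'I_n;
  adj_sym : symmetric adj;
  adj_irr : irreflexive adj }.

Definition edges n (G : graph n) : {set {set 'I_n}} :=
  [set e : {set 'I_n} | [exists u, exists v, adj G u v && (e == [set u; v])]].

(* The subgraphs of G are the pairs (W, F) below; they need not be induced.
   The empty subgraph, which has no vertex at all, is excluded. *)
Definition degenerate (d n : nat) (G : graph n) : Prop :=
  forall (W : {set 'I_n}) (F : rel 'I_n),
    W != set0 ->
    symmetric F ->
    (forall u v, F u v -> [&& u \in W, v \in W & adj G u v]) ->
    exists2 v, v \in W & #|[set u | F v u]| <= d.

Definition dominating n (G : graph n) (S : {set 'I_n}) : Prop :=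
  forall v, v \notin S -> exists2 u, u \in S & adj G u v.

Definition has_dominating_set n (G : graph n) (k : nat) : Prop :=
  exists2 S : {set 'I_n}, dominating G S & #|S| <= k.

(* Algorithms are programs of a unit-cost random access machine with
   registers, a memory with indirect addressing, and structured control flow.
   There is no multiplication: with unit cost it would make the machine
   unreasonably powerful. Subtraction is truncated. *)
Inductive prog : Type :=
  | Skip
  | Const of nat & nat            (* Const r c   : r := c         *)
  | Add of nat & nat & nat        (* Add r a b   : r := a + b     *)
  | Sub of nat & nat & nat        (* Sub r a b   : r := a - b     *)
  | Read of nat & nat             (* Read r a    : r := mem[a]    *)
  | Write of nat & nat            (* Write a b   : mem[a] := b    *)
  | Seq of prog & prog
  | If of nat & prog & prog       (* If r p q    : test r <> 0    *)
  | While of nat & prog.          (* While r p   : test r <> 0    *)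

Record state := State { reg : nat -> nat; mem : nat -> nat }.

Definition upd (f : nat -> nat) (i x : nat) : nat -> nat :=
  fun j => if j == i then x else f j.

Definition set_reg (s : state) (r x : nat) : state :=
  State (upd (reg s) r x) (mem s).

Definition set_mem (s : state) (a x : nat) : state :=
  State (reg s) (upd (mem s) a x).

(* exec p s t s' : started in s, the program p halts in s' after t steps;
   every instruction and every test is one step. *)
Inductive exec : prog -> state -> nat -> state -> Prop :=
  | ExecSkip s : exec Skip s 1 s
  | ExecConst r c s : exec (Const r c) s 1 (set_reg s r c)
  | ExecAdd r a b s :
      exec (Add r a b) s 1 (set_reg s r (reg s a + reg s b))
  | ExecSub r a b s :
      exec (Sub r a b) s 1 (set_reg s r (reg s a - reg s b))
  | ExecRead r a s :
      exec (Read r a) s 1 (set_reg s r (mem s (reg s a)))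
  | ExecWrite a b s :
      exec (Write a b) s 1 (set_mem s (reg s a) (reg s b))
  | ExecSeq p q s1 s2 s3 t1 t2 :
      exec p s1 t1 s2 -> exec q s2 t2 s3 -> exec (Seq p q) s1 (t1 + t2) s3
  | ExecIfTrue r p q s s' t :
      reg s r != 0 -> exec p s t s' -> exec (If r p q) s t.+1 s'
  | ExecIfFalse r p q s s' t :
      reg s r = 0 -> exec q s t s' -> exec (If r p q) s t.+1 s'
  | ExecWhileTrue r p s1 s2 s3 t1 t2 :
      reg s1 r != 0 -> exec p s1 t1 s2 -> exec (While r p) s2 t2 s3 ->
      exec (While r p) s1 (t1 + t2).+1 s3
  | ExecWhileFalse r p s :
      reg s r = 0 -> exec (While r p) s 1 s.

(* Hence "the" result and "the" running time are well defined. *)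
Lemma exec_det p s t1 s1 t2 s2 :
  exec p s t1 s1 -> exec p s t2 s2 -> t1 = t2 /\ s1 = s2.
Proof.
move=> h; elim: h t2 s2 => {p s t1 s1}; intros;
  match goal with H : exec _ _ _ ?s2 |- _ = _ /\ _ = ?s2 => inversion H; subst end;
  repeat match goal with
  | IH : forall t s, exec ?p ?s0 t s -> _, H : exec ?p ?s0 _ _ |- _ =>
      case: (IH _ _ H) => ? ?; subst; clear H
  | e0 : reg ?s ?r = 0, n0 : is_true (reg ?s ?r != 0) |- _ =>
      by rewrite e0 in n0
  end; by [].
Qed.

(* Instances are stored as an adjacency matrix in row-major order. Registers
   0, 1 and 2 hold the number of vertices, the parameter and the address of
   the matrix. *)
Definition holds_instance (s : state) n (G : graph n) (k : nat) : Prop :=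
  [/\ reg s 0 = n, reg s 1 = k
    & forall u v : 'I_n, mem s (reg s 2 + (u * n + v)) = adj G u v].

(* The input matrix is at address 0; everything else is initially 0. *)
Definition input_state n (G : graph n) (k : nat) : state :=
  State (fun r => match r with 0 => n | 1 => k | _ => 0 end)
        (fun a => [exists u : 'I_n, exists v : 'I_n,
                     (a == u * n + v) && adj G u v]).

Lemma holds_input n (G : graph n) k : holds_instance (input_state G k) G k.
Proof.
split=> // u v /=; rewrite add0n; congr nat_of_bool.
apply/existsP/idP => [[x /existsP[y /andP[/eqP E xy]]]|uv]; last first.
  by exists u; apply/existsP; exists v; rewrite eqxx.
have n0 : 0 < n by case: n u {G v x y E xy} => [[]|].
have -> : u = x.
  by apply: val_inj; move/(congr1 (divn^~ n)): E;
     rewrite !divnMDl // !divn_small // !addn0.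
have -> // : v = y.
by apply: val_inj; move/(congr1 (modn^~ n)): E; rewrite !modnMDl !modn_small.
Qed.

(* p is a kernelization algorithm for k-Dominating Set on the input class cls,
   with kernels of at most size k vertices and at most size k edges, computed
   in time n steps on inputs with n vertices. The time bound is only imposed
   for n > 0, since the bounds of interest vanish at n = 0; p must halt with a
   correct output in any case. *)
Definition kernelization (cls : forall n, graph n -> Prop) (p : prog)
    (size time : nat -> nat) : Prop :=
  exists f : nat -> nat,
  forall (n : nat) (G : graph n) (k : nat), cls n G -> 0 < k ->
  exists (t : nat) (s : state) (n' : nat) (G' : graph n') (k' : nat),
    [/\ exec p (input_state G k) t s /\ (0 < n -> t <= time n),
        holds_instance s G' k' /\ 0 < k',
        n' <= size k /\ #|edges G'| <= size k,
        k' <= f k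
      & has_dominating_set G k <-> has_dominating_set G' k'].

(* Main.v *)
Require Import Defs.
From mathcomp Require Import all_boot.
From mathcomp Require Import zify.

Set Implicit Arguments.
Unset Strict Implicit.
Unset Printing Implicit Defensive.

(* Remove vertices of degree at most d one by one, and let T v be the set of
   neighbours of v that remain when v is removed, so #|T v| <= d. Then S
   dominates w iff S meets T w, or w lies in S or in T x for some x in S; the
   last two cases account for at most (d + 1) #|S| vertices. A vertex w is put
   into the core B unless some U included in T w already has many core vertices
   b with U included in T b, where "many" means more than k sets can hit without
   meeting U. A set of at most k vertices that dominates B therefore meets such
   a U, so it dominates w as well, and #|B| = O(d^2 k^(d+1)).

   As dominators it suffices to keep B and one vertex for each trace
   N(v) :&: B. A vertex outside B and outside every T b with b in B has its
   trace inside T v, so there are at most (#|B| + 1) ^ d traces of this kind.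
   The kernel is the induced subgraph on the kept vertices, plus an apex joined
   to the kept vertices outside B, plus a pendant vertex at the apex; k grows
   by 1.

   The machine has unbounded addresses, so the counters indexed by sets U are
   stored in an array at index \sum_(u in U) 2 ^ u. *)

(** * Orientations, the core and the kernel graph *)

(** Whether [w] enters the core is decided once, when [w] is removed and [T w] is final. Core
    membership is never revised and the counters only grow, so a set U that kept [w] out stays a
    valid witness to the end. Domination matters only on B: the apex takes care of the other kept
    vertices, and the pendant vertex forces one of the two new vertices into every solution, which
    is what the extra 1 in the parameter pays for. The time bound comes from n removals, each of
    which scans n vertices while listing the at most 2^d subsets of [T v]. Two features of the
    machine shape the program: products are repeated additions, and room for an output of unknown
    order has to be set aside before the working arrays are placed. Correctness and cost are proved
    for a small loop language in which both are functions, and carried over to the machine by a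
    single simulation. *)

Lemma binary_inj n (f g : 'I_n -> bool) :
  \sum_i f i * 2 ^ i = \sum_i g i * 2 ^ i -> f =1 g.
Proof.
elim: n f g => [|n ih] f g; first by move=> _ [].
rewrite !big_ord_recl /= !expn0 !muln1.
have dbl (h : 'I_n.+1 -> bool) :
    \sum_(i < n) h (lift ord0 i) * 2 ^ bump 0 i =
    2 * \sum_(i < n) h (lift ord0 i) * 2 ^ i.
  by rewrite big_distrr /=; apply: eq_bigr => i _; rewrite /bump add1n expnS mulnCA.
rewrite !dbl => e.
(* All other terms are even, so parity determines bit 0; cancelling it and halving leads to the
   induction hypothesis. *)
have e0 : f ord0 = g ord0 by move: e; case: (f ord0); case: (g ord0) => /=; lia.
move: e; rewrite e0 => /addnI/eqP; rewrite eqn_mul2l /= => /eqP e1 i.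
by case: (unliftP ord0 i) => [j|] -> //; exact: (ih (fun i => f _) (fun i => g _) e1).
Qed.

Definition code n (U : {set 'I_n}) : nat := \sum_(u in U) 2 ^ u.

Lemma code_inj n : injective (@code n).
Proof.
move=> U W e; apply/setP; apply: binary_inj.
have h (V : {set 'I_n}) : \sum_i (i \in V) * 2 ^ i = code V.
  by rewrite /code [RHS]big_mkcond; apply: eq_bigr => i _; case: ifP; rewrite ?mul1n.
by rewrite !h.
Qed.

Lemma code0 n : code (@set0 'I_n) = 0.
Proof. by rewrite /code big_set0. Qed.

Lemma codeU1 n (u : 'I_n) (U : {set 'I_n}) : u \notin U -> code (u |: U) = code U + 2 ^ u.
Proof. by move=> uU; rewrite /code big_setU1 //= addnC. Qed.

Lemma leq_card_bigcup (I T : finType) (S : {set I}) (F : I -> {set T}) :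
  #|\bigcup_(x in S) F x| <= \sum_(x in S) #|F x|.
Proof.
elim/big_rec2: _ => [|i m A _ le]; first by rewrite cards0.
by apply: leq_trans (leq_card_setU _ _) _; rewrite leq_add2l.
Qed.

(** * Orientations of bounded out-degree and the greedy core *)

Definition nbh n (G : graph n) (u : 'I_n) : {set 'I_n} := [set w | adj G u w].

Definition cnt n (T : 'I_n -> {set 'I_n}) (B U : {set 'I_n}) : nat :=
  #|[set b in B | U \subset T b]|.

(** [l] stands for [d - #|U|], the number of elements that [U] may still gain inside some [T b]. A
    vertex that misses [U] accounts for [d + 1] vertices and one counter of the next lower level; k
    times this, plus 1, cannot be reached without meeting [U]. *)
Fixpoint thr (k d l : nat) : nat :=
  if l is l'.+1 then k * (d + 1) + 1 + k * thr k d l' else k * (d + 1) + 1.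

(** [D] is the set of vertices removed so far, so the definition serves as a loop invariant. By the
    last clause an edge from [u] to a surviving vertex lies in [T u], while an edge inside [D] is
    recorded at one of its ends. *)
Definition oriented n (G : graph n) d (D : {set 'I_n}) (T : 'I_n -> {set 'I_n}) :=
  forall u, u \in D -> [/\ T u \subset nbh G u, #|T u| <= d &
    forall v, adj G u v -> v \in T u \/ v \in D /\ u \in T v].

(** The caps on the counters bound B (at [U = set0]) and drive the descent in [core_hits]; the last
    clause supplies, for each vertex left out, the set that every small solution must meet. *)
Definition greedy_core n d k (D B : {set 'I_n}) (T : 'I_n -> {set 'I_n}) :=
  [/\ B \subset D,
      forall U : {set 'I_n}, #|U| <= d -> cnt T B U <= thr k d (d - #|U|)
    & forall w, w \in D -> w \notin B ->
        exists2 U : {set 'I_n}, U \subset T w & thr k d (d - #|U|) <= cnt T B U].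

Definition orient_at n (G : graph n) (D : {set 'I_n}) (T : 'I_n -> {set 'I_n}) v :=
  fun x => if x == v then nbh G v :\: D else T x.

(** A neighbour [w] of [v] already in [D] needs no entry in the new set: [v] is outside [D], so the
    clause for [w] leaves only [v \in T w]. *)
Lemma oriented_step n (G : graph n) d (D : {set 'I_n}) T v :
  v \notin D -> #|nbh G v :\: D| <= d -> oriented G d D T ->
  oriented G d (v |: D) (orient_at G D T v).
Proof.
move=> vD dv or u; rewrite in_setU1 /orient_at; case: eqVneq => [->|uv] /= uD.
  split=> //; first exact: subsetDl.
  move=> w vw; rewrite !inE vw andbT; case: (boolP (w \in D)) => wD; last by left.
  have wv : (w == v) = false by apply: contraNF vD => /eqP <-.
  right; rewrite orbT wv; split=> //.
  have [_ _ /(_ v)] := or w wD; rewrite adj_sym => /(_ vw) [//|[vD' _]].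
  by rewrite vD' in vD.
have [s1 s2 s3] := or u uD; split=> // w uw.
case: (s3 w uw) => [|[wD uT]]; [by left | right].
rewrite in_setU1 wD orbT; split=> //.
by have -> : (w == v) = false by apply: contraNF vD => /eqP <-.
Qed.

Lemma cnt_orient_at n (G : graph n) (D : {set 'I_n}) T v (B U : {set 'I_n}) :
  v \notin B -> cnt (orient_at G D T v) B U = cnt T B U.
Proof.
move=> vB; apply: eq_card => b; rewrite !inE /orient_at.
by case: (eqVneq b v) => // ->; rewrite (negbTE vB).
Qed.

Lemma cntU1 n (T : 'I_n -> {set 'I_n}) (B U : {set 'I_n}) v : v \notin B ->
  cnt T (v |: B) U = (U \subset T v) + cnt T B U.
Proof.
move=> vB; rewrite /cnt; case: (boolP (U \subset T v)) => UT /=.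
  rewrite -[X in _ = X + _](_ : v \notin [set b in B | U \subset T b] = 1 :> nat).
    rewrite -cardsU1; apply: eq_card => b; rewrite !inE.
    by case: (eqVneq b v) => // ->; rewrite UT.
  by rewrite inE (negbTE vB).
rewrite add0n; apply: eq_card => b; rewrite !inE.
by case: (eqVneq b v) => // ->; rewrite (negbTE UT) !andbF.
Qed.

(** The test is strict, so raising the counters of the subsets of the new set by one respects the
    caps; earlier witnesses survive because counters never decrease. *)
Lemma greedy_core_add n (G : graph n) d k (D B : {set 'I_n}) T v :
  v \notin D -> greedy_core d k D B T ->
  (forall U : {set 'I_n}, U \subset nbh G v :\: D -> cnt T B U < thr k d (d - #|U|)) ->
  greedy_core d k (v |: D) (v |: B) (orient_at G D T v).
Proof.
move=> vD [BD up low] ok; have vB : v \notin B by apply: contra vD; apply: subsetP.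
have Tv : orient_at G D T v v = nbh G v :\: D by rewrite /orient_at eqxx.
split; first exact: setUS.
- move=> U Ud; rewrite cntU1 // cnt_orient_at // Tv.
  by case: (boolP (U \subset _)) => [/ok|_] //; rewrite add0n up.
- move=> w; rewrite !inE; case: (eqVneq w v) => //= wv wD wB.
  have [U U1 U2] := low w wD wB; exists U; first by rewrite /orient_at (negbTE wv).
  by rewrite cntU1 // cnt_orient_at // (leq_trans U2) ?leq_addl.
Qed.

Lemma greedy_core_skip n (G : graph n) d k (D B : {set 'I_n}) T v (U : {set 'I_n}) :
  v \notin D -> greedy_core d k D B T ->
  U \subset nbh G v :\: D -> thr k d (d - #|U|) <= cnt T B U ->
  greedy_core d k (v |: D) B (orient_at G D T v).
Proof.
move=> vD [BD up low] UT big; have vB : v \notin B by apply: contra vD; apply: subsetP.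
split; first exact: subset_trans BD (subsetUr _ _).
- by move=> W Wd; rewrite cnt_orient_at // up.
- move=> w; rewrite !inE; case: (eqVneq w v) => [-> _ _|wv /= wD wB].
    by exists U; rewrite ?cnt_orient_at // /orient_at eqxx.
  have [W W1 W2] := low w wD wB; exists W; last by rewrite cnt_orient_at.
  by rewrite /orient_at (negbTE wv).
Qed.

(* If S missed U, each of the at least thr vertices b of B with U in T b would
   be hit by some x in S with b = x, b in T x or x in T b; the first two account
   for at most d + 1 vertices per x, and the last for cnt (x |: U). *)
Lemma core_hits n (G : graph n) d k B T (S U : {set 'I_n}) :
  oriented G d setT T -> greedy_core d k setT B T -> #|S| <= k ->
  (forall b, b \in B -> b \in S \/ exists2 x, x \in S & adj G x b) ->
  thr k d (d - #|U|) <= cnt T B U -> exists2 x, x \in S & x \in U.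
Proof.
move=> or [_ up _] Sk dom big.
case: (boolP [exists x in S, x \in U]) => [/exists_inP[x xS xU]|]; first by exists x.
rewrite negb_exists_in => /forall_inP SU.
(* The branch with 0 is the case [#|U| >= d]: as x is outside [U], the set [x |: U] has more than d
   elements and no [T b] contains it. *)
pose bound := d + 1 + (if #|U| < d then thr k d (d - #|U|).-1 else 0).
suff small : cnt T B U <= k * bound.
  exfalso; move: (leq_trans big small); rewrite /bound.
  case: ltnP => Ud; last first.
    have -> : d - #|U| = 0 by lia.
    by rewrite /=; lia.
  have -> : d - #|U| = (d - #|U|).-1.+1 by lia.
  by rewrite /=; lia.
have Td b : #|T b| <= d by have [] := or b (in_setT b).
pose hit x := x |: T x :|: [set b in B | x |: U \subset T b].
have hitE x : x \in S -> #|hit x| <= bound.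
  move=> xS; apply: leq_trans (leq_card_setU _ _) _; apply: leq_add.
    by rewrite cardsU1; apply: leq_trans (leq_add (leq_b1 _) (Td x)) _; lia.
  have xU1 : #|x |: U| = #|U|.+1 by rewrite cardsU1 SU.
  case: ltnP => Ud.
    have -> : (d - #|U|).-1 = d - #|U|.+1 by lia.
    by rewrite -xU1; apply: up; rewrite xU1.
  rewrite leqn0 cards_eq0; apply/eqP/setP => b; rewrite in_set0 !inE.
  apply/negP => /andP[_ /subset_leq_card]; rewrite xU1.
  by move/leq_trans/(_ (Td b)); rewrite ltnNge Ud.
apply: (@leq_trans (\sum_(x in S) #|hit x|)); last first.
  apply: leq_trans (leq_sum _ hitE) _.
  by rewrite sum_nat_const leq_mul2r Sk orbT.
apply: leq_trans (leq_card_bigcup _ _).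
apply: subset_leq_card; apply/subsetP => b; rewrite inE => /andP[bB UT].
apply/bigcupP; case: (dom b bB) => [bS|[x xS xb]].
  by exists b => //; rewrite !inE eqxx.
exists x => //; rewrite !inE bB subUset sub1set UT andbT /=.
have [_ _ /(_ b xb)] := or x (in_setT x).
by case=> [->|[_ ->]]; rewrite ?orbT.
Qed.
Lemma core_dominates n (G : graph n) d k (B : {set 'I_n}) T (S : {set 'I_n}) :
  oriented G d setT T -> greedy_core d k setT B T -> #|S| <= k ->
  (forall b, b \in B -> b \in S \/ exists2 x, x \in S & adj G x b) ->
  dominating G S.
Proof.
move=> or gc Sk dom v vS; case: (boolP (v \in B)) => vB.
  by case: (dom v vB) => [|//]; rewrite (negbTE vS).
have [_ _ low] := gc; have [U UT big] := low v (in_setT v) vB.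
have [x xS xU] := core_hits or gc Sk dom big; exists x => //.
have [/subsetP sT _ _] := or v (in_setT v).
by have := sT x (subsetP UT x xU); rewrite inE adj_sym.
Qed.

(** Since [k > 0], each of the [l + 1] terms of the unrolled recursion is at most [(d + 2) * k]
    times a power of k with exponent at most [l]. *)
Lemma thr_le k d l : 0 < k -> thr k d l <= (d + 2) * (l + 1) * k ^ (l + 1).
Proof.
move=> k0; elim: l => [|l ih] /=; first by rewrite add0n expn1; nia.
have : k * thr k d l <= k * ((d + 2) * (l + 1) * k ^ (l + 1)) by rewrite leq_mul2l ih orbT.
have : k <= k ^ (l.+1 + 1) by rewrite -[leqLHS]expn1 leq_pexp2l // addn1.
rewrite [in k ^ (l.+1 + 1)]addSn expnS; move: (k ^ (l + 1)) => K; nia.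
Qed.

(** Every [T b] contains the empty set, so the counter of [set0] is [#|B|] itself, and its cap is
    the threshold of level d. *)
Lemma core_size n d k (B : {set 'I_n}) T :
  0 < k -> greedy_core d k setT B T -> #|B| <= (d + 2) * (d + 1) * k ^ (d + 1).
Proof.
move=> k0 [_ up _]; apply: leq_trans _ (thr_le d d k0).
have := up set0; rewrite cards0 subn0 => /(_ isT); apply: leq_trans.
by rewrite leq_eqVlt; apply/orP; left; apply/eqP/eq_card => b; rewrite inE sub0set andbT.
Qed.

(** Such a subset arises in d rounds, each adding an element of B or nothing, with [#|B| + 1]
    choices per round. *)
Lemma card_small_subsets (I : finType) (B : {set I}) d :
  #|[set X : {set I} | X \subset B & #|X| <= d]| <= (#|B| + 1) ^ d.
Proof.
elim: d => [|d ih].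
  rewrite expn0 -(cards1 (@set0 I)); apply: subset_leq_card; apply/subsetP => X.
  by rewrite !inE leqn0 cards_eq0 => /andP[].
set F := [set X : {set I} | X \subset B & #|X| <= d] in ih.
apply: (@leq_trans #|F :|: [set x |: X | x in B, X in F]|).
  apply: subset_leq_card; apply/subsetP => X; rewrite !inE => /andP[XB Xd].
  rewrite XB /=; case: leqP => //= Xd'; have [x xX] : exists x, x \in X.
    by apply/set0Pn; rewrite -card_gt0; lia.
  apply/imset2P; exists x (X :\ x); last by rewrite setD1K.
    exact: subsetP xX.
  rewrite inE (subset_trans (subsetDl _ _) XB) /=.
  by move: Xd; rewrite (cardsD1 x) xX.
apply: leq_trans (leq_card_setU _ _) _.
rewrite expnS mulnDl mul1n addnC leq_add //.
rewrite curry_imset2X; apply: leq_trans (leq_imset_card _ _) _.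
by rewrite cardsX leq_mul2l ih orbT.
Qed.

(** * The kernel graph: edges, equivalence and size *)

Lemma card_edges_le n (G : graph n) (T : 'I_n -> {set 'I_n}) D :
  (forall u v, adj G u v -> v \in T u \/ u \in T v) -> (forall u, #|T u| <= D) ->
  #|edges G| <= n * D.
Proof.
move=> cov TD.
apply: (@leq_trans #|\bigcup_(u in [set: 'I_n]) [set [set u; v] | v in T u]|).
  apply: subset_leq_card; apply/subsetP => e; rewrite inE.
  case/existsP => u /existsP[v /andP[uv /eqP ->]]; apply/bigcupP.
  case: (cov u v uv) => h; first by exists u => //; apply/imsetP; exists v.
  by exists v => //; apply/imsetP; exists u; rewrite // setUC.
apply: leq_trans (leq_card_bigcup _ _) _.
apply: (@leq_trans (\sum_(u in [set: 'I_n]) D)).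
  by apply: leq_sum => u _; apply: leq_trans (leq_imset_card _ _) (TD u).
by rewrite sum_nat_const cardsT card_ord.
Qed.

(* Positions below m = size ks stand for the vertices in ks, position m for a
   vertex that dominates the kept vertices outside B, and m + 1 for a pendant
   vertex attached to it. *)
Definition kernel_adj n (G : graph n) (B : {set 'I_n}) (ks : seq 'I_n) (x0 : 'I_n)
    (i j : nat) : bool :=
  let m := size ks in
  if i < m then
    if j < m then adj G (nth x0 ks i) (nth x0 ks j)
    else (j == m) && (nth x0 ks i \notin B)
  else if i == m then
    if j < m then nth x0 ks j \notin B else j == m.+1
  else j == m.

Lemma kernel_adj_sym n (G : graph n) B ks x0 :
  symmetric (fun i j : 'I_(size ks).+2 => kernel_adj G B ks x0 i j).
Proof.
move=> i j; rewrite /kernel_adj; have := ltn_ord i; have := ltn_ord j.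
case: (ltngtP j (size ks)) => hj; case: (ltngtP i (size ks)) => hi hj2 hi2 //=;
  rewrite 1?adj_sym //; lia.
Qed.

Lemma kernel_adj_irr n (G : graph n) B ks x0 :
  irreflexive (fun i : 'I_(size ks).+2 => kernel_adj G B ks x0 i).
Proof.
move=> i; rewrite /kernel_adj; case: (ltngtP i (size ks)) => hi //=.
  by rewrite adj_irr.
by rewrite hi ltn_eqF.
Qed.

Definition kernel_graph n (G : graph n) B ks x0 : graph (size ks).+2 :=
  Graph (@kernel_adj_sym n G B ks x0) (@kernel_adj_irr n G B ks x0).

(** The orientation extends to the kernel graph: a kept vertex gets its kept out-neighbours and the
    apex, and the apex gets the pendant vertex, so [d + 1] bounds every out-degree. *)
Lemma kernel_edges n (G : graph n) d (B : {set 'I_n}) T ks x0 :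
  oriented G d setT T -> uniq ks ->
  #|edges (kernel_graph G B ks x0)| <= (size ks).+2 * (d + 1).
Proof.
move=> or uks; set m := size ks.
pose small (i : 'I_m.+2) := [set j : 'I_m.+2 | (j < m) && (nth x0 ks j \in T (nth x0 ks i))].
pose T' (i : 'I_m.+2) := if i < m then inord m |: small i else [set ord_max].
apply: (card_edges_le (T := T')) => [i j|i] /=.
  rewrite /kernel_adj /T' -/m; have := ltn_ord i; have := ltn_ord j.
  case: (ltngtP i m) => hi; case: (ltngtP j m) => hj hj2 hi2 //=.
  - move=> ij; have [_ _ /(_ _ ij) []] := or (nth x0 ks i) (in_setT _).
      by move=> h; left; rewrite !inE hj h orbT.
    by move=> [_ h]; right; rewrite !inE hi h orbT.
  - move=> _; left; have -> : j = inord m by apply: val_inj; rewrite /= inordK.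
    exact: setU11.
  - by move=> _; right; rewrite inE; apply/eqP/val_inj => /=; lia.
  - move=> _; right; have -> : i = inord m by apply: val_inj; rewrite /= inordK.
    exact: setU11.
  - by move=> /eqP h; left; rewrite inE; apply/eqP/val_inj.
  - by move=> /eqP h; left; rewrite inE; apply/eqP/val_inj.
rewrite /T'; case: ltnP => him; last by rewrite cards1 addn1.
apply: leq_trans (leq_card_setU _ _) _; rewrite cards1 addnC leq_add //.
have [_ Td _] := or (nth x0 ks i) (in_setT _); apply: leq_trans Td.
have inj : {in small i &, injective (fun j : 'I_m.+2 => nth x0 ks j)}.
  move=> j1 j2; rewrite !inE => /andP[h1 _] /andP[h2 _] /eqP.
  by rewrite nth_uniq // => /eqP/val_inj.
rewrite -(card_in_imset inj); apply: subset_leq_card; apply/subsetP => v.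
by case/imsetP => j; rewrite inE => /andP[_ h] ->.
Qed.

(** Forward, each vertex of a solution is replaced by a kept vertex whose trace on B is at least as
    large, and the apex is added. Backward, the pendant vertex forces a solution to use one of the
    two new vertices; neither is adjacent to B, so discarding them leaves at most k vertices that
    still dominate B, and the last hypothesis extends this to all of G. *)
Lemma kernel_equiv n (G : graph n) k (B : {set 'I_n}) ks x0 :
  uniq ks -> {subset B <= ks} ->
  (forall x, x \notin ks -> exists2 y, y \in ks & nbh G x :&: B \subset nbh G y :&: B) ->
  (forall S : {set 'I_n}, #|S| <= k ->
    (forall b, b \in B -> b \in S \/ exists2 x, x \in S & adj G x b) -> dominating G S) ->
  has_dominating_set G k <-> has_dominating_set (kernel_graph G B ks x0) k.+1.
Proof.
move=> uks sB reps core; set m := size ks; set G' := kernel_graph _ _ _ _.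
have zm : m < m.+2 by [].
pose z : 'I_m.+2 := Ordinal zm.
have adjz (i : 'I_m.+2) : i < m -> nth x0 ks i \notin B -> adj G' z i.
  by move=> im iB; rewrite /= /kernel_adj -/m ltnn eqxx im.
have adjk (i j : 'I_m.+2) : i < m -> j < m ->
    adj G' i j = adj G (nth x0 ks i) (nth x0 ks j).
  by move=> im jm; rewrite /= /kernel_adj -/m im jm.
split=> [[S dS Sk]|[S dS Sk]].
  (* Equality is included because a vertex of B may be covered by lying in S. An x in B is kept and
     represents itself. *)
  have repP x : exists j : 'I_m.+2, j < m /\ forall b, b \in B ->
      (b == x) || adj G x b -> (b == nth x0 ks j) || adj G (nth x0 ks j) b.
    have pos y : y \in ks -> exists2 j : 'I_m.+2, j < m & nth x0 ks j = y.
      move=> yk; have im : index y ks < m by rewrite index_mem.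
      by exists (Ordinal (leqW (leqW im))); rewrite //= nth_index.
    case: (boolP (x \in ks)) => xk.
      by have [j jm <-] := pos x xk; exists j.
    have [y yk /subsetP sub] := reps x xk; have [j jm ej] := pos y yk.
    exists j; split=> // b bB; rewrite ej; case: eqP => [e|_ /= xb].
      by move: xk; rewrite -e sB.
    by have := sub b; rewrite !inE xb bB /= andbT => /(_ isT) ->; rewrite orbT.
  have [rep repE] := fin_all_exists repP.
  exists (z |: rep @: S); last first.
    rewrite cardsU1; apply: leq_trans (leq_add (leq_b1 _) (leq_imset_card _ _)) _.
    by rewrite add1n ltnS.
  move=> i; rewrite in_setU1 negb_or => /andP[iz iS].
  have im2 := ltn_ord i; move: iz; rewrite -val_eqE /= => iz.
  case: (ltnP i m) => im; last first.
    exists z; first exact: setU11.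
    by rewrite /= /kernel_adj -/m ltnn eqxx ltnNge im /=; apply/eqP; lia.
  case: (boolP (nth x0 ks i \in B)) => iB; last first.
    by exists z; [exact: setU11 | exact: adjz].
  have [x xS xi] : exists2 x, x \in S & (nth x0 ks i == x) || adj G x (nth x0 ks i).
    case: (boolP (nth x0 ks i \in S)) => h; first by exists (nth x0 ks i); rewrite ?eqxx.
    by have [x xS h'] := dS _ h; exists x; rewrite // h' orbT.
  have [jm /(_ _ iB xi) /orP[|h]] := repE x.
    rewrite nth_uniq // => /eqP/val_inj e.
    by move: iS; rewrite e imset_f.
  exists (rep x); first by rewrite in_setU1 imset_f ?orbT.
  exact: etrans (adjk (rep x) i jm im) h.
pose S0 := [set i in S | i < m].
have S0k : #|[set nth x0 ks i | i : 'I_m.+2 in S0]| <= k.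
  apply: leq_trans (leq_imset_card _ _) _; rewrite -ltnS; apply: leq_trans Sk.
  (* The only neighbour of the pendant vertex [ord_max] is the apex, so one of the two belongs to
     S. *)
  have [i iS im] : exists2 i, i \in S & m <= i.
    case: (boolP (ord_max \in S)) => h; first by exists ord_max => /=.
    have [u uS] := dS _ h; rewrite /= /kernel_adj -/m => hu; exists u => //.
    by move: hu; case: ltnP => // _; rewrite ltnNge leqnSn /= gtn_eqF.
  apply: proper_card; apply/properP; split; first by apply/subsetP => j; rewrite inE => /andP[].
  by exists i => //; rewrite inE ltnNge im andbF.
exists [set nth x0 ks i | i : 'I_m.+2 in S0]; rewrite //.
apply: core => // b bB; have bk := sB b bB.
have im : index b ks < m by rewrite index_mem.
pose i : 'I_m.+2 := Ordinal (leqW (leqW im)).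
have ei : nth x0 ks i = b by rewrite /= nth_index.
case: (boolP (i \in S)) => iS.
  by left; apply/imsetP; exists i; rewrite // inE iS.
have [j jS ji] := dS i iS; right; case: (ltnP j m) => jm; last first.
  move: ji; rewrite /= /kernel_adj -/m ltnNge jm /= im nth_index // bB.
  by case: ifP => // _ /eqP; lia.
exists (nth x0 ks j); first by apply/imsetP; exists j; rewrite // inE jS.
by rewrite -ei; exact: esym (etrans (esym ji) (adjk j i jm im)).
Qed.

Lemma kernel_size n (G : graph n) d (B : {set 'I_n}) T ks :
  oriented G d setT T -> uniq ks ->
  {in ks &, forall x y, x \notin B -> y \notin B ->
     nbh G x :&: B = nbh G y :&: B -> x = y} ->
  size ks <= #|B| * (d + 1) + (#|B| + 1) ^ d.
Proof.
move=> or uks inj; pose near := B :|: \bigcup_(b in B) T b.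
rewrite -(card_uniqP uks) -(cardsE (mem ks)).
pose far := [set x in ks] :\: near.
apply: (@leq_trans #|near :|: far|).
  by apply: subset_leq_card; apply/subsetP => x; rewrite !inE => ->; rewrite andbT orbN.
apply: leq_trans (leq_card_setU _ _) _; apply: leq_add.
  apply: leq_trans (leq_card_setU _ _) _; rewrite addnC mulnDr muln1 leq_add //.
  apply: leq_trans (leq_card_bigcup _ _) _.
  apply: (@leq_trans (\sum_(b in B) d)); last by rewrite sum_nat_const.
  by apply: leq_sum => b _; have [_ Td _] := or b (in_setT b).
apply: leq_trans (card_small_subsets B d).
have injf : {in far &, injective (fun x => nbh G x :&: B)}.
  move=> x y; rewrite !inE !negb_or => /andP[/andP[xB _] xk] /andP[/andP[yB _] yk].
  exact: inj.
rewrite -(card_in_imset injf); apply: subset_leq_card; apply/subsetP => X.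
case/imsetP => x; rewrite !inE negb_or => /andP[/andP[xB /bigcupP xT] _] ->.
rewrite subsetIr /=; have [_ Td cov] := or x (in_setT x).
apply: leq_trans Td; apply: subset_leq_card; apply/subsetP => b.
rewrite !inE => /andP[xb bB]; case: (cov b xb) => // -[_ h].
by case: xT; exists b.
Qed.

(** * A loop language compiled to the random access machine *)

Local Notation mem := Defs.mem.

Inductive expr :=
  | Num of nat
  | Var of nat
  | Plus of expr & expr
  | Minus of expr & expr
  | Mem of expr
  | Arr of nat & expr.

(* Sixteen unbounded arrays are interleaved above the address in register 3. *)
Definition arr (s : state) (j x : nat) := mem s (reg s 3 + (j + 16 * x)).

Fixpoint eval (s : state) (e : expr) : nat :=
  match e with
  | Num c => c
  | Var r => reg s r
  | Plus a b => eval s a + eval s b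
  | Minus a b => eval s a - eval s b
  | Mem a => mem s (eval s a)
  | Arr j a => arr s j (eval s a)
  end.

(** The number of rounds of a loop is evaluated on entry, so every command terminates, and [run] and
    [cost] can be defined by structural recursion. *)
Inductive cmd :=
  | Nop
  | Set_ of nat & expr
  | SetMem of expr & expr
  | SetArr of nat & expr & expr
  | Cat of cmd & cmd
  | Cond of expr & cmd & cmd
  | Loop of nat & expr & cmd.

Fixpoint run (c : cmd) (s : state) : state :=
  match c with
  | Nop => s
  | Set_ r e => set_reg s r (eval s e)
  | SetMem a b => set_mem s (eval s a) (eval s b)
  | SetArr j a b => set_mem s (reg s 3 + (j + 16 * eval s a)) (eval s b)
  | Cat c1 c2 => run c2 (run c1 s)
  | Cond e c1 c2 => if eval s e != 0 then run c1 s else run c2 s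
  | Loop i e c1 =>
      iteri (eval s e) (fun j s1 => run c1 (set_reg s1 i j)) s
  end.

(** The constants count compiled instructions. [Var] takes 2 because a copy is an addition to a
    register set to 0; [Arr] adds 7 for the address and 1 for the read. *)
Fixpoint ecost (e : expr) : nat :=
  match e with
  | Num _ => 1
  | Var _ => 2
  | Plus a b | Minus a b => ecost a + (ecost b + 1)
  | Mem a => ecost a + 1
  | Arr _ a => ecost a + 8
  end.

(** The 6 per round are the test of [While] and five instructions that set the index, advance the
    counter and decrease the number of rounds left. The successor after the sum is the final,
    failing test, and the 1 before it clears the counter. *)
Fixpoint cost (c : cmd) (s : state) : nat :=
  match c with
  | Nop => 1
  | Set_ r e => ecost e + 2
  | SetMem a b => ecost a + (ecost b + 1)
  | SetArr _ a b => ecost a + 7 + (ecost b + 1)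
  | Cat c1 c2 => cost c1 s + cost c2 (run c1 s)
  | Cond e c1 c2 =>
      ecost e + (if eval s e != 0 then cost c1 s else cost c2 s).+1
  | Loop i e c1 =>
      ecost e + (1 + (\sum_(0 <= j < eval s e)
        (cost c1 (set_reg (iteri j (fun j s1 => run c1 (set_reg s1 i j)) s) i j)
         + 6)).+1)
  end.

(** Four doublings multiply the index by 16, as the machine has no product. *)
Definition caddr (p : prog) (j t : nat) : prog :=
  Seq p (Seq (Add t t t) (Seq (Add t t t) (Seq (Add t t t) (Seq (Add t t t)
    (Seq (Const t.+1 j) (Seq (Add t t.+1 t) (Add t 3 t))))))).

Fixpoint cexpr (e : expr) (t : nat) : prog :=
  match e with
  | Num c => Const t c
  | Var r => Seq (Const t 0) (Add t t r)
  | Plus a b => Seq (cexpr a t) (Seq (cexpr b t.+1) (Add t t t.+1))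
  | Minus a b => Seq (cexpr a t) (Seq (cexpr b t.+1) (Defs.Sub t t t.+1))
  | Mem a => Seq (cexpr a t) (Read t t)
  | Arr j a => Seq (caddr (cexpr a t) j t) (Read t t)
  end.

(* Registers from t on are scratch; the loop counters live there, so the body of
   a loop cannot change the number of iterations. *)
Fixpoint compile (c : cmd) (t : nat) : prog :=
  match c with
  | Nop => Skip
  | Set_ r e => Seq (cexpr e t) (Seq (Const t.+1 0) (Add r t t.+1))
  | SetMem a b => Seq (cexpr a t) (Seq (cexpr b t.+1) (Write t t.+1))
  | SetArr j a b => Seq (caddr (cexpr a t) j t) (Seq (cexpr b t.+1) (Write t t.+1))
  | Cat c1 c2 => Seq (compile c1 t) (compile c2 t)
  | Cond e c1 c2 => Seq (cexpr e t) (If t (compile c1 t) (compile c2 t))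
  | Loop i e c1 => Seq (cexpr e t) (Seq (Const t.+1 0)
      (While t (Seq (Const t.+2 0) (Seq (Add i t.+1 t.+2)
        (Seq (compile c1 t.+3)
        (Seq (Const t.+2 1) (Seq (Add t.+1 t.+1 t.+2) (Defs.Sub t t t.+2))))))))
  end.

Fixpoint ebound (e : expr) (R : nat) : bool :=
  match e with
  | Num _ => true
  | Var r => r < R
  | Plus a b | Minus a b => ebound a R && ebound b R
  | Mem a | Arr _ a => ebound a R
  end.

Fixpoint cbound (c : cmd) (R : nat) : bool :=
  match c with
  | Nop => true
  | Set_ r e => (r < R) && ebound e R
  | SetMem a b | SetArr _ a b => ebound a R && ebound b R
  | Cat c1 c2 => cbound c1 R && cbound c2 R
  | Cond e c1 c2 => [&& ebound e R, cbound c1 R & cbound c2 R]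
  | Loop i e c1 => [&& i < R, ebound e R & cbound c1 R]
  end.

(** * Simulation of the loop language by machine code *)

Lemma updE f i x j : upd f i x j = if j == i then x else f j.
Proof. by []. Qed.

(** [R] separates the registers of the loop language from the scratch registers, on which the
    machine state [s] may differ from the abstract state [h]. *)
Definition sim (R : nat) (s h : state) : Prop :=
  (forall r, r < R -> reg s r = reg h r) /\ mem s = mem h.

Lemma eval_sim R s h e :
  3 < R -> sim R s h -> ebound e R -> eval s e = eval h e.
Proof.
move=> R3 [er em]; elim: e => //=.
- by move=> a iha b ihb /andP[/iha-> /ihb->].
- by move=> a iha b ihb /andP[/iha-> /ihb->].
- by move=> a iha /iha->; rewrite em.
- by move=> j a iha /iha->; rewrite /arr em er.
Qed.

Ltac upd_neq := rewrite /= ?updE; repeat (case: eqP => // ?); try lia.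

Definition computes (p : prog) (t c x : nat) (s : state) : Prop :=
  exists s', [/\ exec p s c s', mem s' = mem s,
    forall r, r < t -> reg s' r = reg s r & reg s' t = x].

Lemma computes_seq p q t c1 c2 x y s :
  computes p t c1 x s ->
  (forall s', mem s' = mem s -> (forall r, r < t -> reg s' r = reg s r) ->
     reg s' t = x -> computes q t c2 y s') ->
  computes (Seq p q) t (c1 + c2) y s.
Proof.
move=> [s1 [e1 m1 r1 x1]] /(_ s1 m1 r1 x1) [s2 [e2 m2 r2 x2]].
exists s2; split=> //; first exact: ExecSeq e1 e2.
- by rewrite m2.
- by move=> r rt; rewrite r2 ?r1.
Qed.

Lemma computes_dbl t s : computes (Add t t t) t 1 (2 * reg s t) s.
Proof.
exists (set_reg s t (reg s t + reg s t)); split=> //; first exact: ExecAdd.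
- by move=> r rt; upd_neq.
- by rewrite /= updE eqxx; lia.
Qed.

Lemma computes_addr j p t c x s : 3 < t -> computes p t c x s ->
  computes (caddr p j t) t (c + 7) (reg s 3 + (j + 16 * x)) s.
Proof.
move=> t3 h; apply: computes_seq h _ => s1 m1 r1 x1.
rewrite -[7]/(1 + (1 + (1 + (1 + 3)))).
apply: computes_seq (computes_dbl _ _) _ => s2 m2 r2 x2.
apply: computes_seq (computes_dbl _ _) _ => s3 m3 r3 x3.
apply: computes_seq (computes_dbl _ _) _ => s4 m4 r4 x4.
apply: computes_seq (computes_dbl _ _) _ => s5 m5 r5 x5.
eexists; split.
- apply: (@ExecSeq _ _ _ _ _ 1 2); first exact: ExecConst.
  by apply: (@ExecSeq _ _ _ _ _ 1 1); exact: ExecAdd.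
- by [].
- by move=> r rt; upd_neq.
- rewrite /= !updE !eqxx /=.
  have -> : (t == t.+1) = false by lia.
  have -> : (3 == t) = false by lia.
  have -> : (3 == t.+1) = false by lia.
  by rewrite r5 // r4 // r3 // r2 // r1 // x5 x4 x3 x2 x1; lia.
Qed.

Lemma cexpr_ok e R t s :
  3 < R -> R <= t -> ebound e R -> computes (cexpr e t) t (ecost e) (eval s e) s.
Proof.
move=> R3; elim: e t s => /=.
- move=> c t s _ _; exists (set_reg s t c); split=> //; first exact: ExecConst.
  + by move=> r rt; upd_neq.
  + by rewrite /= updE eqxx.
- move=> r t s Rt rR; exists (set_reg (set_reg s t 0) t (0 + reg s r)); split=> //.
  + apply: (@ExecSeq _ _ _ _ _ 1 1); first exact: ExecConst.
    have := ExecAdd t t r (set_reg s t 0); rewrite /= !updE eqxx.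
    by have -> : (r == t) = false by lia.
  + by move=> r0 rt; upd_neq.
  + by rewrite /= updE eqxx.
- move=> a iha b ihb t s Rt /andP[ha hb].
  apply: computes_seq (iha _ _ Rt ha) _ => s1 m1 r1 x1.
  have [|s2 [e2 m2 r2 x2]] := ihb t.+1 s1 _ hb; first by lia.
  have e12 : eval s1 b = eval s b.
    by apply: (@eval_sim R) => //; split=> // r rR; apply: r1; lia.
  exists (set_reg s2 t (reg s2 t + reg s2 t.+1)); split=> //.
  + by apply: ExecSeq e2 _; exact: ExecAdd.
  + move=> r rt /=; rewrite updE; have -> : (r == t) = false by lia.
    by rewrite r2 ?r1 //; lia.
  + by rewrite /= updE eqxx x2 r2 // x1 e12.
- move=> a iha b ihb t s Rt /andP[ha hb].
  apply: computes_seq (iha _ _ Rt ha) _ => s1 m1 r1 x1.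
  have [|s2 [e2 m2 r2 x2]] := ihb t.+1 s1 _ hb; first by lia.
  have e12 : eval s1 b = eval s b.
    by apply: (@eval_sim R) => //; split=> // r rR; apply: r1; lia.
  exists (set_reg s2 t (reg s2 t - reg s2 t.+1)); split=> //.
  + by apply: ExecSeq e2 _; exact: ExecSub.
  + move=> r rt /=; rewrite updE; have -> : (r == t) = false by lia.
    by rewrite r2 ?r1 //; lia.
  + by rewrite /= updE eqxx x2 r2 // x1 e12.
- move=> a iha t s Rt ha.
  apply: computes_seq (iha _ _ Rt ha) _ => s1 m1 r1 x1.
  exists (set_reg s1 t (mem s1 (reg s1 t))); split=> //; first exact: ExecRead.
  + by move=> r rt; upd_neq.
  + by rewrite /= updE eqxx x1 m1.
- move=> j a iha t s Rt ha; rewrite -[8]/(7 + 1) addnA.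
  apply: computes_seq (computes_addr j _ (iha _ s Rt ha)) _; first by lia.
  move=> s1 m1 r1 x1.
  exists (set_reg s1 t (mem s1 (reg s1 t))); split=> //; first exact: ExecRead.
  + by move=> r rt; upd_neq.
  + by rewrite /= updE eqxx x1 m1.
Qed.

(** The last clause protects the scratch registers below [t], which hold the counters of the
    enclosing loops. *)
Definition sim_exec (R t : nat) (p : prog) (s : state) (T : nat) (h' : state) :=
  exists s' T', [/\ exec p s T' s', T' <= T, sim R s' h' &
    forall r, R <= r < t -> reg s' r = reg s r].

Lemma sim_computes R t p c x s h :
  R <= t -> computes p t c x s -> sim R s h ->
  exists s', [/\ exec p s c s', sim R s' h, reg s' t = x &
    forall r, R <= r < t -> reg s' r = reg s r].
Proof.
move=> Rt [s1 [e1 m1 r1 x1]] [er em]; exists s1; split=> //.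
- by split; [move=> r rR; rewrite r1 ?er //; lia | rewrite m1].
- by move=> r rR; apply: r1; lia.
Qed.

Lemma sim_seq R t p q s T1 T2 h2 (P : state -> Prop) :
  (exists s1, [/\ exec p s T1 s1, P s1 &
     forall r, R <= r < t -> reg s1 r = reg s r]) ->
  (forall s1, P s1 -> sim_exec R t q s1 T2 h2) ->
  sim_exec R t (Seq p q) s (T1 + T2) h2.
Proof.
move=> [s1 [e1 p1 r1]] /(_ s1 p1) [s2 [T' [e2 le2 m2 r2]]].
exists s2, (T1 + T'); split=> //; first exact: ExecSeq e1 e2.
- by rewrite leq_add2l.
- by move=> r rR; rewrite r2 ?r1.
Qed.

Lemma store_ok R t p b c x s h :
  3 < R -> R <= t -> ebound b R -> sim R s h -> computes p t c x s ->
  sim_exec R t (Seq p (Seq (cexpr b t.+1) (Write t t.+1))) s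
    (c + (ecost b + 1)) (set_mem h x (eval h b)).
Proof.
move=> R3 Rt hb sh /(sim_computes Rt)/(_ sh) [s1 [e1 sh1 x1 r1]].
have [|s2 [e2 m2 r2 x2]] := @cexpr_ok b R t.+1 s1 R3 _ hb; first by lia.
exists (set_mem s2 (reg s2 t) (reg s2 t.+1)), (c + (ecost b + 1)); split=> //.
- by apply: ExecSeq e1 _; apply: ExecSeq e2 _; exact: ExecWrite.
- split.
  + by move=> r rR /=; rewrite r2 ?(proj1 sh1) //; lia.
  + by rewrite /= m2 r2 // x1 x2 (proj2 sh1) (eval_sim R3 sh1 hb).
- by move=> r rR /=; rewrite r2 ?r1 //; lia.
Qed.

Lemma compile_ok c R t s h :
  3 < R -> R <= t -> cbound c R -> sim R s h ->
  sim_exec R t (compile c t) s (cost c h) (run c h).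
Proof.
move=> R3; elim: c t s h => /=.
- by move=> t s h Rt _ sh; exists s, 1; split=> //; exact: ExecSkip.
- move=> r e t s h Rt /andP[rR he] sh.
  have [s1 [e1 sh1 x1 r1]] := sim_computes Rt (cexpr_ok s R3 Rt he) sh.
  exists (set_reg (set_reg s1 t.+1 0) r (reg s1 t + 0)), (ecost e + 2); split=> //.
  + apply: ExecSeq e1 _; apply: (@ExecSeq _ _ _ _ _ 1 1); first exact: ExecConst.
    have := ExecAdd r t t.+1 (set_reg s1 t.+1 0); rewrite /= !updE eqxx.
    by have -> : (t == t.+1) = false by lia.
  + split; last exact: (proj2 sh1).
    move=> r0 r0R /=; rewrite !updE x1 addn0 (eval_sim R3 sh he).
    case: ifP => // _; have -> : (r0 == t.+1) = false by lia.
    exact: (proj1 sh1).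
  + move=> r0 r0R /=; rewrite !updE (r1 r0) //.
    have -> : (r0 == r) = false by lia.
    by have -> : (r0 == t.+1) = false by lia.
- move=> a b t s h Rt /andP[ha hb] sh.
  by rewrite -(eval_sim R3 sh ha); apply: store_ok => //; apply: cexpr_ok R3 Rt ha.
- move=> j a b t s h Rt /andP[ha hb] sh.
  rewrite -(eval_sim R3 sh ha) -(proj1 sh 3 R3); apply: store_ok => //.
  by apply: computes_addr; [lia | apply: cexpr_ok R3 Rt ha].
- move=> c1 ih1 c2 ih2 t s h Rt /andP[h1 h2] sh.
  have [s1 [T1 [e1 l1 sh1 r1]]] := ih1 t s h Rt h1 sh.
  have [s2 [T2 [e2 l2 sh2 r2]]] := ih2 t s1 _ Rt h2 sh1.
  exists s2, (T1 + T2); split=> //; first exact: ExecSeq e1 e2.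
  + exact: leq_add.
  + by move=> r rR; rewrite r2 ?r1.
- move=> e c1 ih1 c2 ih2 t s h Rt /and3P[he h1 h2] sh.
  apply: (sim_seq (P := fun s1 => sim R s1 h /\ reg s1 t = eval h e)).
    have [s1 [e1 sh1 x1 r1]] := sim_computes Rt (cexpr_ok s R3 Rt he) sh.
    by exists s1; split=> //; split=> //; rewrite x1 (eval_sim R3 sh he).
  move=> s1 [sh1 x1]; case: ifP => e0.
    have [s2 [T2 [e2 l2 sh2 r2]]] := ih1 t s1 h Rt h1 sh1.
    by exists s2, T2.+1; split=> //; apply: ExecIfTrue => //; rewrite x1.
  have [s2 [T2 [e2 l2 sh2 r2]]] := ih2 t s1 h Rt h2 sh1.
  exists s2, T2.+1; split=> //; apply: ExecIfFalse => //.
  by rewrite x1; move/negbFE/eqP: e0.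
- move=> i e c ih t s h Rt /and3P[iR he hc] sh.
  apply: (sim_seq (P := fun s1 => sim R s1 h /\ reg s1 t = eval h e)).
    have [s1 [e1 sh1 x1 r1]] := sim_computes Rt (cexpr_ok s R3 Rt he) sh.
    by exists s1; split=> //; split=> //; rewrite x1 (eval_sim R3 sh he).
  move=> s0 [sh0 x0]; set F := (fun j s1 => run c (set_reg s1 i j)).
  set N := eval h e in x0 *.
  apply: (sim_seq (P := fun s1 => [/\ sim R s1 h, reg s1 t = N & reg s1 t.+1 = 0])).
    exists (set_reg s0 t.+1 0); split.
    + exact: ExecConst.
    + split=> /=; last by rewrite updE eqxx.
      * split; last exact: (proj2 sh0).
        move=> r rR /=; rewrite updE; have -> : (r == t.+1) = false by lia.
        exact: (proj1 sh0).
      * by rewrite updE; have -> : (t == t.+1) = false by lia.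
    + by move=> r rR /=; rewrite updE; have -> : (r == t.+1) = false by lia.
  move=> s1 [sh1 xt xt1].
  set W := While _ _.
  (* Induction on the number m of rounds left: register [t] holds m and [t.+1] holds the index j,
     while the abstract side has completed j rounds. *)
  suff loop m j s2 : N - j = m -> j <= N -> reg s2 t = m -> reg s2 t.+1 = j ->
      sim R s2 (iteri j F h) ->
      sim_exec R t W s2
        (\sum_(j <= i0 < N) (cost c (set_reg (iteri i0 F h) i i0) + 6)).+1
        (iteri N F h).
    by apply: (loop N 0); rewrite ?subn0.
  move=> {s1 sh1 xt xt1 s0 sh0 x0 s sh}.
  move: s2 => s1; rewrite {}/W.
  elim: m j s1 => [|m ihm] j s1 Em jN xt xt1 sh1.
    have -> : j = N by lia.
    exists s1, 1; split=> //; first by apply: ExecWhileFalse.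
    by have -> : N = j by lia.
  rewrite big_ltn; last by lia.
  set s2 := set_reg (set_reg s1 t.+2 0) i j.
  have sh2 : sim R s2 (set_reg (iteri j F h) i j).
    split; last exact: (proj2 sh1).
    move=> r rR /=; rewrite !updE; case: ifP => // _.
    have -> : (r == t.+2) = false by lia.
    exact: (proj1 sh1).
  have [|s3 [T3 [e3 l3 sh3 r3]]] := ih t.+3 s2 _ _ hc sh2; first by lia.
  pose s4 := set_reg (set_reg (set_reg s3 t.+2 1) t.+1 j.+1) t m.
  have xs2 r : R <= r -> reg s2 r = if r == t.+2 then 0 else reg s1 r.
    by move=> rR; rewrite /= !updE; have -> : (r == i) = false by lia.
  have y1 : reg s3 t.+1 = j.
    by rewrite r3 ?xs2; [have -> : (t.+1 == t.+2) = false by lia | lia..].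
  have y0 : reg s3 t = m.+1.
    by rewrite r3 ?xs2; [have -> : (t == t.+2) = false by lia | lia..].
  have {}e3 : exec (Seq (Const t.+2 0) (Seq (Add i t.+1 t.+2)
        (Seq (compile c t.+3)
        (Seq (Const t.+2 1) (Seq (Add t.+1 t.+1 t.+2) (Defs.Sub t t t.+2)))))) s1
        (1 + (1 + (T3 + (1 + (1 + 1))))) s4.
    apply: ExecSeq; first exact: ExecConst.
    apply: ExecSeq.
      have := ExecAdd i t.+1 t.+2 (set_reg s1 t.+2 0).
      rewrite /= !updE eqxx; have -> : (t.+1 == t.+2) = false by lia.
      by rewrite xt1 addn0; apply.
    apply: ExecSeq e3 _.
    apply: ExecSeq; first exact: ExecConst.
    apply: ExecSeq.
      have := ExecAdd t.+1 t.+1 t.+2 (set_reg s3 t.+2 1).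
      rewrite /= !updE eqxx; have -> : (t.+1 == t.+2) = false by lia.
      by rewrite y1 addn1; apply.
    have := ExecSub t t t.+2 (set_reg (set_reg s3 t.+2 1) t.+1 j.+1).
    rewrite /= !updE eqxx; have -> : (t == t.+2) = false by lia.
    have -> : (t == t.+1) = false by lia.
    have -> : (t.+2 == t.+1) = false by lia.
    by rewrite y0 subn1; apply.
  have [|||||s5 [T5 [e5 l5 sh5 r5]]] := ihm j.+1 s4.
  + by lia.
  + by lia.
  + by rewrite /= updE eqxx.
  + by rewrite /= !updE eqxx; have -> : (t.+1 == t) = false by lia.
  + split; last exact: (proj2 sh3).
    move=> r rR; rewrite /= !updE; have -> : (r == t) = false by lia.
    have -> : (r == t.+1) = false by lia.
    have -> : (r == t.+2) = false by lia.
    exact: (proj1 sh3).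
  exists s5, ((1 + (1 + (T3 + (1 + (1 + 1)))) + T5).+1); split=> //.
  + by apply: ExecWhileTrue e3 e5; rewrite xt.
  + by lia.
  + move=> r rR; rewrite r5 // /s4 /= !updE.
    have -> : (r == t) = false by lia.
    have -> : (r == t.+1) = false by lia.
    have -> : (r == t.+2) = false by lia.
    rewrite r3; last by lia.
    by rewrite xs2; [have -> : (r == t.+2) = false by lia | lia].
Qed.

(** * Time-bounded program logic *)

Arguments arr : simpl never.

(* W and A list the registers and the arrays that a command may write. *)
Fixpoint within (W A : seq nat) (c : cmd) : bool :=
  match c with
  | Nop => true
  | Set_ r _ => r \in W
  | SetMem _ _ => false
  | SetArr j _ _ => j \in A
  | Cat c1 c2 | Cond _ c1 c2 => within W A c1 && within W A c2
  | Loop i _ c1 => (i \in W) && within W A c1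
  end.

(** A write to register 3 would move all arrays at once, and the interleaving separates arrays only
    for numbers below 16. *)
Definition framed (W A : seq nat) : bool := (3 \notin W) && all (fun j => j < 16) A.

Definition same (W A : seq nat) (s s' : state) : Prop :=
  [/\ forall r, r \notin W -> reg s' r = reg s r,
      forall j x, j < 16 -> j \notin A -> arr s' j x = arr s j x
    & forall a, a < reg s 3 -> mem s' a = mem s a].

Lemma same_trans W A s1 s2 s3 :
  framed W A -> same W A s1 s2 -> same W A s2 s3 -> same W A s1 s3.
Proof.
move=> /andP[W3 _] [a1 a2 a3] [b1 b2 b3]; split=> [r rW|j x j16 jA|a aL].
- by rewrite b1 ?a1.
- by rewrite b2 ?a2.
- by rewrite b3 ?a3 // a1.
Qed.

Lemma addr_eq L j j' x x' : j < 16 -> j' < 16 ->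
  (L + (j + 16 * x) == L + (j' + 16 * x')) = (j == j') && (x == x').
Proof. by move=> h h'; apply/eqP/andP => [e|[/eqP-> /eqP->]] //; split; apply/eqP; lia. Qed.

Lemma arr_set s L j j' x y v : reg s 3 = L -> j < 16 -> j' < 16 ->
  arr (set_mem s (L + (j + 16 * x)) v) j' y =
  if (j' == j) && (y == x) then v else arr s j' y.
Proof. by move=> <- h h'; rewrite /arr /= updE addr_eq. Qed.

Lemma arr_reg s r v j x : r != 3 -> arr (set_reg s r v) j x = arr s j x.
Proof. by move=> h; rewrite /arr /= updE eq_sym (negbTE h). Qed.

Lemma arr_ext s s' j x : mem s' = mem s -> reg s' 3 = reg s 3 -> arr s' j x = arr s j x.
Proof. by rewrite /arr => -> ->. Qed.

Lemma low_set s a j x v : a < reg s 3 ->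
  mem (set_mem s (reg s 3 + (j + 16 * x)) v) a = mem s a.
Proof. by move=> h; rewrite /= updE; case: eqP => //; lia. Qed.

Lemma same_set W A s r v : framed W A -> r \in W -> same W A s (set_reg s r v).
Proof.
move=> /andP[W3 _] rW; have r3 : (3 == r) = false by apply: contraNF W3 => /eqP ->.
split=> //= [r' r'W|j x _ _]; rewrite ?/arr /= updE ?r3 //.
by have -> : (r' == r) = false by apply: contraNF r'W => /eqP ->.
Qed.

Lemma frame W A c s : framed W A -> within W A c -> same W A s (run c s).
Proof.
move=> fr; elim: c s => //=.
- by move=> r e s rW; exact: same_set.
- move=> j a b s jA; split=> //; last by move=> a'; exact: low_set.
  move=> j' x j'16 j'A; rewrite arr_set //.
    by have -> : (j' == j) = false by apply: contraNF j'A => /eqP ->.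
  by case/andP: fr => _ /allP; apply.
- by move=> c1 ih1 c2 ih2 s /andP[w1 w2]; apply: same_trans (ih1 _ w1) (ih2 _ w2).
- by move=> e c1 ih1 c2 ih2 s /andP[w1 w2]; case: ifP => _; [exact: ih1|exact: ih2].
- move=> i e c ih s /andP[iW wc]; elim: (eval s e) => //= m ihm.
  apply: same_trans (fr) ihm _; apply: same_trans (fr) _ (ih _ wc).
  exact: same_set.
Qed.

(** A weaker frame that tracks registers only. Unlike [within] it admits [SetMem], by which the
    output matrix is written. *)
Fixpoint sets (W : seq nat) (c : cmd) : bool :=
  match c with
  | Nop | SetMem _ _ | SetArr _ _ _ => true
  | Set_ r _ => r \in W
  | Cat c1 c2 | Cond _ c1 c2 => sets W c1 && sets W c2
  | Loop i _ c1 => (i \in W) && sets W c1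
  end.

Lemma frame_reg W c s r : sets W c -> r \notin W -> reg (run c s) r = reg s r.
Proof.
move=> + rW; elim: c s => //=.
- move=> r' e s r'W; rewrite updE.
  by have -> : (r == r') = false by apply: contraNF rW => /eqP ->.
- by move=> c1 ih1 c2 ih2 s /andP[w1 w2]; rewrite ih2 ?ih1.
- by move=> e c1 ih1 c2 ih2 s /andP[w1 w2]; case: ifP => _; rewrite ?ih1 ?ih2.
- move=> i e c ih s /andP[iW wc]; elim: (eval s e) => //= m ihm.
  rewrite ih //= updE.
  by have -> : (r == i) = false by apply: contraNF rW => /eqP ->.
Qed.

Definition does (c : cmd) (s : state) (T : nat) (Q : state -> Prop) : Prop :=
  Q (run c s) /\ cost c s <= T.

Lemma does_le c s T T' Q : does c s T Q -> T <= T' -> does c s T' Q.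
Proof. by move=> [q t] TT'; split=> //; exact: leq_trans TT'. Qed.

Lemma does_weaken c s T (Q Q' : state -> Prop) :
  does c s T Q' -> (forall s', Q' s' -> Q s') -> does c s T Q.
Proof. by move=> [q t] QQ'; split=> //; exact: QQ'. Qed.

Lemma does_nop s (Q : state -> Prop) : Q s -> does Nop s 1 Q.
Proof. by []. Qed.

Lemma does_set r e s (Q : state -> Prop) :
  Q (set_reg s r (eval s e)) -> does (Set_ r e) s (ecost e + 2) Q.
Proof. by []. Qed.

Lemma does_setmem a b s (Q : state -> Prop) :
  Q (set_mem s (eval s a) (eval s b)) -> does (SetMem a b) s (ecost a + (ecost b + 1)) Q.
Proof. by []. Qed.

Lemma does_setarr j a b s (Q : state -> Prop) :
  Q (set_mem s (reg s 3 + (j + 16 * eval s a)) (eval s b)) ->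
  does (SetArr j a b) s (ecost a + 7 + (ecost b + 1)) Q.
Proof. by []. Qed.

Lemma does_cat c1 c2 s T1 T2 Q :
  does c1 s T1 (fun s1 => does c2 s1 T2 Q) -> does (Cat c1 c2) s (T1 + T2) Q.
Proof. by move=> [[q t2] t1]; split=> //=; exact: leq_add. Qed.

(** Charging the sum of the branches instead of their maximum costs a constant factor and keeps the
    bounds free of case distinctions. *)
Lemma does_cond e c1 c2 s T1 T2 Q :
  (eval s e != 0 -> does c1 s T1 Q) -> (eval s e = 0 -> does c2 s T2 Q) ->
  does (Cond e c1 c2) s (ecost e + (T1 + T2).+1) Q.
Proof.
rewrite /does /=; case: (eqVneq (eval s e) 0) => e0 h1 h2 /=.
  by have [//|q t] := h2; split=> //; lia.
by have [//|q t] := h1; split=> //; lia.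
Qed.

(** No running time is amortized, so one bound [T] serves all rounds. The frame is established along
    with the invariant, so [I] need not mention registers outside [W]. *)
Lemma does_loop_reg W i e c s (I : nat -> state -> Prop) N T (Q : state -> Prop) :
  sets W (Loop i e c) -> eval s e = N -> I 0 s ->
  (forall j s', j < N -> (forall r, r \notin W -> reg s' r = reg s r) -> I j s' ->
    does c (set_reg s' i j) T (I j.+1)) ->
  (forall s', (forall r, r \notin W -> reg s' r = reg s r) -> I N s' -> Q s') ->
  does (Loop i e c) s (ecost e + 2 + N * (T + 6)) Q.
Proof.
move=> w eN I0 step; set F := (fun j s1 => run c (set_reg s1 i j)).
have inv j : j <= N -> I j (iteri j F s) /\
    (forall r, r \notin W -> reg (iteri j F s) r = reg s r).
  elim: j => //= j ih jN; have [Ij frj] := ih (ltnW jN).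
  split; first by have [] := step j _ jN frj Ij.
  move=> r rW; rewrite /F (@frame_reg W) //=; last by case/andP: w.
  rewrite updE frj //; case/andP: w => iW _.
  by have -> : (r == i) = false by apply: contraNF rW => /eqP ->.
move=> fin; split; rewrite /= eN -/F.
  by have [IN frN] := inv N (leqnn N); exact: fin.
suff le : \sum_(0 <= j < N) (cost c (set_reg (iteri j F s) i j) + 6) <= N * (T + 6) by lia.
apply: (@leq_trans (\sum_(0 <= j < N) (T + 6))); last by rewrite sum_nat_const_nat subn0.
rewrite !big_mkord; apply: leq_sum => j _; rewrite leq_add2r.
have [Ij frj] := inv j (ltnW (ltn_ord j)).
by have [] := step j _ (ltn_ord j) frj Ij.
Qed.

Lemma does_loop W A i e c s (I : nat -> state -> Prop) N T (Q : state -> Prop) :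
  framed W A -> within W A (Loop i e c) -> eval s e = N -> I 0 s ->
  (forall j s', j < N -> same W A s s' -> I j s' ->
    does c (set_reg s' i j) T (I j.+1)) ->
  (forall s', same W A s s' -> I N s' -> Q s') ->
  does (Loop i e c) s (ecost e + 2 + N * (T + 6)) Q.
Proof.
move=> fr w eN I0 step fin.
have sw c0 : within W A c0 -> sets W c0.
  elim: c0 => //= [c1 h1 c2 h2|_ c1 h1 c2 h2|i0 _ c1 h1] /andP[w1 w2].
  - by rewrite h1 ?h2.
  - by rewrite h1 ?h2.
  - by rewrite w1 h1.
apply: (does_loop_reg (W := W) (I := fun j s' => same W A s s' /\ I j s')) => //.
- exact: sw.
- move=> j s' jN _ [sm Ij]; have [q t] := step j s' jN sm Ij; split=> //; split=> //.
  case/andP: (w) => iW wc.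
  apply: same_trans (fr) sm _; apply: same_trans (fr) (same_set _ _ fr iW) (frame _ fr wc).
- by move=> s' _ [? ?]; exact: fin.
Qed.

(** * The kernelization program *)

Local Notation rN := 0 (only parsing).
Local Notation rK := 1 (only parsing).
Local Notation rOut := 2 (only parsing).
Local Notation rBase := 3 (only parsing).
Local Notation rMul := 4 (only parsing).
Local Notation rT := 5 (only parsing).
Local Notation rV := 6 (only parsing).
Local Notation rU := 7 (only parsing).
Local Notation rRow := 8 (only parsing).
Local Notation rLen := 9 (only parsing).
Local Notation rI := 10 (only parsing).
Local Notation rAcc := 11 (only parsing).
Local Notation rQ := 12 (only parsing).
Local Notation rM := 13 (only parsing).
Local Notation rCode := 14 (only parsing).
Local Notation rSize := 15 (only parsing).
Local Notation rOutRow := 16 (only parsing).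
Local Notation rApexRow := 17 (only parsing).

Local Notation aDeg := 0 (only parsing).
Local Notation aDead := 1 (only parsing).
Local Notation aCore := 2 (only parsing).
Local Notation aPow := 3 (only parsing).
Local Notation aCnt := 4 (only parsing).
Local Notation aSeen := 5 (only parsing).
Local Notation aThr := 6 (only parsing).
Local Notation aCode := 7 (only parsing).
Local Notation aLevel := 8 (only parsing).
Local Notation aKept := 9 (only parsing).

Local Notation "c ;; d" := (Cat c d) (at level 65, right associativity).

(** Repeated addition, in time linear in the first factor; at every call that factor is at most
    [n + 2] or equal to [d + 1]. *)
Definition mul r a b : cmd :=
  Set_ r (Num 0) ;; Loop rMul (Var a) (Set_ r (Plus (Var r) (Var b))).

(** The output matrix will start right after the input, at address [n * n]. Its order is still
    unknown but at most [n + 2], so a square block of that order is reserved before the base of the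
    arrays. *)
Definition layout : cmd :=
  mul rRow rN rN ;; Set_ rOut (Var rRow) ;;
  Set_ rSize (Plus (Var rN) (Num 2)) ;; mul rRow rSize rSize ;;
  Set_ rBase (Plus (Var rOut) (Var rRow)).

Definition powers : cmd :=
  Set_ rRow (Num 1) ;;
  Loop rU (Var rN)
    (SetArr aPow (Var rU) (Var rRow) ;; Set_ rRow (Plus (Var rRow) (Var rRow))).

Definition thresholds (d : nat) : cmd :=
  Set_ rAcc (Num (d + 1)) ;; mul rQ rAcc rK ;;
  Set_ rQ (Plus (Var rQ) (Num 1)) ;; Set_ rRow (Var rQ) ;;
  Loop rU (Num (d + 1))
    (SetArr aThr (Var rU) (Var rRow) ;; mul rAcc rK rRow ;;
     Set_ rRow (Plus (Var rQ) (Var rAcc))).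

Definition degrees : cmd :=
  Set_ rRow (Num 0) ;;
  Loop rU (Var rN)
    (Set_ rAcc (Num 0) ;;
     Loop rI (Var rN)
       (Set_ rAcc (Plus (Var rAcc) (Mem (Plus (Var rRow) (Var rI))))) ;;
     SetArr aDeg (Var rU) (Var rAcc) ;;
     Set_ rRow (Plus (Var rRow) (Var rN))).

(** By truncated subtraction the sum vanishes exactly for an unremoved vertex with at most d
    surviving neighbours; among several, the last one is taken. *)
Definition pick_vertex (d : nat) : cmd :=
  Loop rU (Var rN)
    (Cond (Plus (Arr aDead (Var rU)) (Minus (Arr aDeg (Var rU)) (Num d)))
      Nop (Set_ rV (Var rU))).

Definition double_list : cmd :=
  Loop rI (Var rLen)
    (SetArr aCode (Plus (Var rLen) (Var rI))
       (Plus (Arr aCode (Var rI)) (Arr aPow (Var rU))) ;;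
     SetArr aLevel (Plus (Var rLen) (Var rI))
       (Minus (Arr aLevel (Var rI)) (Num 1))) ;;
  Set_ rLen (Plus (Var rLen) (Var rLen)).

(* The list in aCode and aLevel enumerates the subsets U of T v: aCode holds the
   code of U, and aLevel holds d - #|U|, the index of its threshold in aThr. *)
Definition remove_vertex (d : nat) : cmd :=
  mul rRow rV rN ;; SetArr aDead (Var rV) (Num 1) ;;
  SetArr aCode (Num 0) (Num 0) ;; SetArr aLevel (Num 0) (Num d) ;;
  Set_ rLen (Num 1) ;;
  Loop rU (Var rN)
    (Cond (Mem (Plus (Var rRow) (Var rU)))
      (SetArr aDeg (Var rU) (Minus (Arr aDeg (Var rU)) (Num 1)) ;;
       Cond (Arr aDead (Var rU)) Nop double_list)
      Nop).

Definition test_vertex : cmd :=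
  Set_ rAcc (Num 1) ;;
  Loop rI (Var rLen)
    (Cond (Minus (Arr aThr (Arr aLevel (Var rI))) (Arr aCnt (Arr aCode (Var rI))))
      Nop (Set_ rAcc (Num 0))).

Definition keep_vertex : cmd :=
  Cond (Var rAcc)
    (SetArr aCore (Var rV) (Num 1) ;;
     Loop rI (Var rLen)
       (SetArr aCnt (Arr aCode (Var rI))
         (Plus (Arr aCnt (Arr aCode (Var rI))) (Num 1))))
    Nop.

Definition build_core (d : nat) : cmd :=
  Loop rT (Var rN)
    (pick_vertex d ;; remove_vertex d ;; test_vertex ;; keep_vertex).

Definition trace_code : cmd :=
  Set_ rCode (Num 0) ;;
  Loop rU (Var rN)
    (Cond (Mem (Plus (Var rRow) (Var rU)))
      (Cond (Arr aCore (Var rU))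
        (Set_ rCode (Plus (Var rCode) (Arr aPow (Var rU)))) Nop) Nop).

(** The truncated difference is nonzero only for a vertex outside the core whose trace has been seen
    before; core vertices are kept whatever their trace. *)
Definition choose_vertices : cmd :=
  Set_ rM (Num 0) ;; Set_ rRow (Num 0) ;;
  Loop rT (Var rN)
    (trace_code ;;
     Cond (Minus (Arr aSeen (Var rCode)) (Arr aCore (Var rT))) Nop
       (SetArr aKept (Var rM) (Var rT) ;; Set_ rM (Plus (Var rM) (Num 1)) ;;
        SetArr aSeen (Var rCode) (Num 1)) ;;
     Set_ rRow (Plus (Var rRow) (Var rN))).

(** The apex row is filled one entry at a time along with the other rows. The entry in the pendant
    column keeps its initial value 0. *)
Definition output_row : cmd :=
  Set_ rV (Arr aKept (Var rT)) ;; mul rRow rV rN ;;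
  Loop rU (Var rM)
    (SetMem (Plus (Var rOutRow) (Var rU))
       (Mem (Plus (Var rRow) (Arr aKept (Var rU))))) ;;
  SetMem (Plus (Var rOutRow) (Var rM)) (Minus (Num 1) (Arr aCore (Var rV))) ;;
  SetMem (Plus (Var rApexRow) (Var rT)) (Minus (Num 1) (Arr aCore (Var rV))) ;;
  Set_ rOutRow (Plus (Var rOutRow) (Var rSize)).

Definition output : cmd :=
  Set_ rSize (Plus (Var rM) (Num 2)) ;; mul rApexRow rM rSize ;;
  Set_ rApexRow (Plus (Var rOut) (Var rApexRow)) ;;
  Set_ rOutRow (Var rOut) ;;
  Loop rT (Var rM) output_row ;;
  SetMem (Plus (Var rApexRow) (Plus (Var rM) (Num 1))) (Num 1) ;;
  SetMem (Plus (Var rApexRow) (Plus (Var rSize) (Var rM))) (Num 1) ;;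
  Set_ rN (Var rSize) ;; Set_ rK (Plus (Var rK) (Num 1)).

(* For k >= n the input is already small enough. *)
Definition kernelize (d : nat) : cmd :=
  Cond (Minus (Var rN) (Var rK))
    (layout ;; powers ;; thresholds d ;; degrees ;; build_core d ;;
     choose_vertices ;; output)
    Nop.

Arguments upd f i x j /.

(** * Memory layout and precomputed tables *)

Lemma does_mul N r a b s (Q : state -> Prop) :
  reg s a <= N -> r \notin [:: 3; 4] -> r != a -> r != b -> b != 4 ->
  (forall s', (forall r', r' \notin [:: r; 4] -> reg s' r' = reg s r') ->
     mem s' = mem s -> reg s' r = reg s a * reg s b -> Q s') ->
  does (mul r a b) s (7 + N * 13) Q.
Proof.
move=> aN.
rewrite !inE negb_or => /andP[r3 r4] ra rb b4 fin.
apply: does_le.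
  apply: does_cat; apply: does_set.
  apply: (does_loop_reg (N := reg s a) (W := [:: r; 4])
            (I := fun j s' => mem s' = mem s /\ reg s' r = j * reg s b)).
  - by rewrite /= !inE !eqxx orbT.
  - by rewrite /= eq_sym (negbTE ra).
  - by rewrite /= eqxx.
  - move=> j s' jN frs [ms rs]; apply: does_set; split=> //=.
    rewrite eqxx (negbTE r4) (negbTE b4) rs frs /=.
      by rewrite eq_sym (negbTE rb) mulSn addnC.
    by rewrite !inE negb_or eq_sym rb.
  - move=> s' frs [ms rs]; apply: fin => // r' hr; rewrite frs //=.
    by move: hr; rewrite !inE negb_or => /andP[/negbTE->].
by rewrite /=; nia.
Qed.

(** This holds from the layout up to the output phase: all cells below the arrays are as at the
    start, so the input matrix is intact and the reserved output block is zero. *)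
Definition env n (G : graph n) k (s : state) : Prop :=
  [/\ reg s 0 = n, reg s 1 = k, reg s 2 = n * n, reg s 3 = n * n + (n + 2) * (n + 2)
    & forall a, a < reg s 3 -> mem s a = mem (input_state G k) a].

Lemma env_same n (G : graph n) k W A s s' :
  all (fun r => 3 < r) W -> same W A s s' -> env G k s -> env G k s'.
Proof.
move=> /allP Wgt [a1 _ a3] [e0 e1 e2 e3 e4].
have lo r : r <= 3 -> reg s' r = reg s r.
  by move=> r3; apply: a1; apply/negP => /Wgt; rewrite ltnNge r3.
split; rewrite ?lo // => a aL; rewrite a3 // e4 //; lia.
Qed.

Lemma env_set n (G : graph n) k s r v : 3 < r -> env G k s -> env G k (set_reg s r v).
Proof.
move=> r3 [e0 e1 e2 e3 e4].
have lo r' : r' <= 3 -> (r' == r) = false by lia.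
by split; rewrite /= ?lo.
Qed.

Lemma env_setarr n (G : graph n) k s L j x v :
  reg s 3 = L -> env G k s -> env G k (set_mem s (L + (j + 16 * x)) v).
Proof.
move=> <- [e0 e1 e2 e3 e4]; split=> //= a aL.
by case: eqP => [|_]; [lia | exact: e4].
Qed.

Lemma env_adj n (G : graph n) k s (u v : 'I_n) : env G k s ->
  mem s (u * n + v) = adj G u v.
Proof.
move=> [_ _ _ e3 e4]; rewrite e4.
  by have [_ _ h] := holds_input G k; rewrite -h.
rewrite e3; have := ltn_ord u; have := ltn_ord v; nia.
Qed.

Lemma input_zero n (G : graph n) k a : n * n <= a -> mem (input_state G k) a = 0.
Proof.
move=> na /=; apply/eqP; rewrite eqb0; apply/existsP => -[u /existsP[v /andP[/eqP e _]]].
by have := ltn_ord u; have := ltn_ord v; nia.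
Qed.

Lemma layout_does n (G : graph n) k :
  does layout (input_state G k) (46 + n * 13 + (n + 2) * 13)
    (fun s => env G k s /\ forall j x, arr s j x = 0).
Proof.
apply: does_le.
  apply: does_cat; apply: (does_mul (N := n)) => // s1 f1 m1 x1.
  apply: does_cat; apply: does_set.
  apply: does_cat; apply: does_set.
  apply: does_cat; apply: (does_mul (N := n + 2)) => // [|s2 f2 m2 x2].
    by rewrite /= f1.
  apply: does_set.
  move: x2; rewrite /= f1 //= => x2.
  have e2 : reg s2 2 = n * n by rewrite f2 //= x1.
  split; last first.
    by move=> j x; rewrite /arr /= m2 m1 e2 x2; apply: input_zero; lia.
  split=> /=.
  - by rewrite f2 //= f1.
  - by rewrite f2 //= f1.
  - exact: e2.
  - by rewrite e2 x2.
  - by move=> a _; rewrite m2 /= m1.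
by rewrite /=; lia.
Qed.

Lemma does_same W A c s T (Q : state -> Prop) :
  framed W A -> within W A c -> does c s T Q ->
  does c s T (fun s' => same W A s s' /\ Q s').
Proof. by move=> fr w [q t]; split=> //; split=> //; exact: frame. Qed.

Lemma powers_does n s : reg s rN = n ->
  does powers s (100 + n * 100) (fun s' => same [:: 7; 8] [:: aPow] s s' /\
    forall u, u < n -> arr s' aPow u = 2 ^ u).
Proof.
move=> en; apply: does_same => //; apply: does_le.
  apply: does_cat; apply: does_set.
  apply: (does_loop (W := [:: 7; 8]) (A := [:: aPow]) (N := n)
    (I := fun j s' => reg s' 8 = 2 ^ j /\ forall u, u < j -> arr s' aPow u = 2 ^ u)) => //.
    move=> j s' jn sm [r8 pw]; apply: does_cat; apply: does_setarr; apply: does_set.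
    rewrite /= r8; split; first by rewrite expnS; lia.
    move=> u uj; rewrite arr_reg // arr_set //= arr_reg //=; case: eqP => [->|ne] //.
    by apply: pw; lia.
  by move=> s' sm [_ h].
by rewrite /=; lia.
Qed.

Lemma thresholds_does n (G : graph n) d k s : env G k s -> k <= n ->
  does (thresholds d) s (100 + (d + 1) * 100 + (d + 1) * (n * 100))
    (fun s' => same [:: 4; 7; 8; 11; 12] [:: aThr] s s' /\
      forall l, l <= d -> arr s' aThr l = thr k d l).
Proof.
move=> [e0 e1 e2 e3 e4] kn; apply: does_same => //; apply: does_le.
  apply: does_cat; apply: does_set.
  apply: does_cat; apply: (does_mul (N := d + 1)) => //= s1 f1 m1 x1.
  apply: does_cat; apply: does_set; apply: does_cat; apply: does_set.
  rewrite /= x1 e1.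
  apply: (does_loop (W := [:: 4; 7; 8; 11]) (A := [:: aThr]) (N := d + 1)
    (I := fun j s' => reg s' 8 = thr k d j /\
                      forall l, l < j -> arr s' aThr l = thr k d l)) => //.
  - by split=> //=; lia.
  - move=> j s' jn sm [r8 pw]; apply: does_cat; apply: does_setarr => /=.
    have [f _ _] := sm.
    apply: does_cat; apply: (does_mul (N := n)) => // [|s2 f2 m2 x2].
      by rewrite /= f //= f1 //= e1.
    apply: does_set; rewrite /= x2 /= r8 f //= f1 //= e1 f2 //= f //=.
    split; first by lia.
    move=> u uj; rewrite arr_reg // (arr_ext _ _ m2) ?f2 // arr_set //= arr_reg //.
    case: eqP => [->|ne] //.
    by apply: pw; lia.
  - by move=> s' sm [_ h] l ld; apply: h; lia.
by rewrite /=; nia.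
Qed.

(** What a loop over increasing vertices has met after j rounds; the invariants for degrees, subset
    lists and traces are phrased with it. *)
Definition prefix n (A : {set 'I_n}) (j : nat) : {set 'I_n} := [set w in A | w < j].

Lemma prefix0 n (A : {set 'I_n}) : prefix A 0 = set0.
Proof. by apply/setP => w; rewrite !inE andbF. Qed.

Lemma prefix_all n (A : {set 'I_n}) : prefix A n = A.
Proof. by apply/setP => w; rewrite !inE ltn_ord andbT. Qed.

Lemma prefixS n (A : {set 'I_n}) (j : 'I_n) :
  prefix A j.+1 = if j \in A then j |: prefix A j else prefix A j.
Proof.
apply/setP => w; case: ifP => jA; rewrite !inE ltnS leq_eqVlt val_eqE.
  by case: (eqVneq w j) => [->|] //; rewrite jA.
by case: (eqVneq w j) => [->|] //; rewrite jA.
Qed.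

Lemma prefix_notin n (A : {set 'I_n}) (j : 'I_n) : j \notin prefix A j.
Proof. by rewrite inE ltnn andbF. Qed.

Lemma mem_row n (G : graph n) k s row (u : 'I_n) (i : 'I_n) :
  env G k s -> row = u * n -> mem s (row + i) = (i \in nbh G u).
Proof. by move=> e ->; rewrite inE (env_adj _ _ e). Qed.

Lemma degrees_does n (G : graph n) k s : env G k s ->
  does degrees s (100 + n * (100 + n * 100))
    (fun s' => same [:: 7; 8; 10; 11] [:: aDeg] s s' /\
      forall u : 'I_n, arr s' aDeg u = #|nbh G u|).
Proof.
move=> e; have [e0 e1 e2 e3 e4] := e; apply: does_same => //; apply: does_le.
  apply: does_cat; apply: does_set.
  apply: (does_loop (W := [:: 7; 8; 10; 11]) (A := [:: aDeg]) (N := n)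
    (I := fun j s' => reg s' 8 = j * n /\
                      forall u : 'I_n, u < j -> arr s' aDeg u = #|nbh G u|)) => //.
  - move=> j s1 jn sm [r8 dg]; apply: does_cat; apply: does_set => /=.
    have [f _ _] := sm; pose u := Ordinal jn.
    apply: does_cat; apply: (does_loop (W := [:: 10; 11]) (A := [::]) (N := n)
      (I := fun i s' => reg s' 11 = #|prefix (nbh G u) i|)) => //.
    + by rewrite /= f.
    + by rewrite /= prefix0 cards0.
    + move=> i s2 iN sm2 r11; apply: does_set => /=.
      rewrite r11 -[i]/(nat_of_ord (Ordinal iN)) prefixS.
      have [f2 _ _] := sm2.
      have rowE : reg s2 8 = u * n by rewrite f2.
      have es2 : env G k s2.
        apply: env_same sm2 _ => //; do 2 apply: env_set => //.
        by apply: env_same sm _ => //; apply: env_set.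
      rewrite (mem_row (Ordinal iN) es2 rowE).
      by case: ifP => _; rewrite ?addn0 // cardsU1 prefix_notin addnC.
    move=> s2 sm2 r11; apply: does_cat; apply: does_setarr; apply: does_set => /=.
    have [f2 a2 _] := sm2; rewrite f2 //= r8 f2 //= f //= e0; split; first by lia.
    move=> w wj; rewrite arr_reg // arr_set //= f2 //=.
    case: eqP => [wj'|ne].
      by rewrite r11 prefix_all; congr #|pred_of_set (nbh G _)|; apply: val_inj.
    by rewrite a2 // !arr_reg //; apply: dg; lia.
  - by move=> s' sm [_ h] u; apply: h.
by rewrite /=; nia.
Qed.

(** * One round of elimination: picking, removing and testing a vertex *)

Lemma pick_vertex_does n d s (good : pred 'I_n) : reg s rN = n ->
  (forall u : 'I_n, (arr s aDead u + (arr s aDeg u - d) == 0) = good u) ->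
  (exists u, good u) ->
  does (pick_vertex d) s (10 + n * 100)
    (fun s' => same [:: 6; 7] [::] s s' /\ exists2 v : 'I_n, reg s' rV = v & good v).
Proof.
move=> en gd [u0 gu0]; apply: does_same => //; apply: does_le.
  (* The chosen-vertex register is meaningless until a good vertex has been met, hence a conditional
     invariant. *)
  apply: (does_loop (W := [:: 6; 7]) (A := [::]) (N := n)
    (I := fun j s' => (exists2 u : 'I_n, u < j & good u) ->
            exists2 v : 'I_n, reg s' rV = v & good v)) => //.
  - by move=> [].
  - move=> j s' jn sm ih; have [f a _] := sm.
    have := gd (Ordinal jn); rewrite -!(a _ _) //= => gj.
    apply: does_cond => /= e; rewrite !arr_reg //= in e.
      apply: does_nop => -[u uj gu]; apply: ih; exists u => //.
      move: uj; rewrite ltnS leq_eqVlt => /orP[/eqP uj|//].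
      by move: gu; rewrite (_ : u = Ordinal jn) -?gj ?(negbTE e) //; apply: val_inj.
    apply: does_set => /= _; exists (Ordinal jn) => //.
    by rewrite -gj e.
  - by move=> s' sm; apply; exists u0.
by rewrite /=; lia.
Qed.

Definition lists n (d : nat) (us : seq {set 'I_n}) (s : state) : Prop :=
  reg s rLen = size us /\ forall i, i < size us ->
    arr s aCode i = code (nth set0 us i) /\ arr s aLevel i = d - #|nth set0 us i|.

Lemma double_list_does n d (us : seq {set 'I_n}) (u : 'I_n) s N :
  lists d us s -> reg s rU = u -> arr s aPow u = 2 ^ u ->
  (forall U, U \in us -> u \notin U) -> size us <= N ->
  does double_list s (100 + N * 100) (fun s' => same [:: 9; 10] [:: aCode; aLevel] s s' /\
    lists d (us ++ [seq u |: U | U <- us]) s').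
Proof.
move=> [len ls] ru pu uU usN; apply: does_same => //; apply: (does_le (T := 100 + size us * 100)).
  apply: does_le.
    apply: does_cat.
    apply: (does_loop (W := [:: 10]) (A := [:: aCode; aLevel]) (N := size us)
    (I := fun j s' => forall i, i < size us + j ->
      arr s' aCode i = code (nth set0 (us ++ [seq u |: U | U <- us]) i) /\
      arr s' aLevel i = d - #|nth set0 (us ++ [seq u |: U | U <- us]) i|)) => //.
    - by move=> i; rewrite addn0 => iu; rewrite nth_cat iu; apply: ls.
    - move=> j s' jn [f a _] ih; apply: does_cat; apply: does_setarr; apply: does_setarr => /=.
      have [|c1 c2] := ih j; first by lia.
      rewrite nth_cat jn in c1 c2.
      have uj : u \notin nth set0 us j by apply: uU; apply: mem_nth.
      rewrite !f // len ru; move=> i ij; rewrite !arr_set //= ?f //=.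
      rewrite !arr_reg // c1 c2 (a aPow) // pu; case: eqP => [->|ne]; last by apply: ih; lia.
      rewrite nth_cat ltnNge leq_addr /= addKn (nth_map set0) //.
      by rewrite codeU1 // cardsU1 uj -subnDA addn1 add1n.
    - move=> s' [f a _] ih; apply: does_set; split=> [|i] /=.
        by rewrite size_cat size_map f // len.
      by rewrite size_cat size_map !arr_reg //; apply: ih.
  by rewrite /=; lia.
by rewrite leq_add2l leq_mul2r usN orbT.
Qed.

(** Adding [u] is injective on sets that avoid it, and yields sets outside the old list. Freedom
    from repetition matters because [keep_vertex] raises a counter once per list entry. *)
Lemma subsets_double (I : finType) (us : seq {set I}) (X : {set I}) u :
  uniq us -> (forall U, (U \in us) = (U \subset X)) -> u \notin X ->
  uniq (us ++ [seq u |: U | U <- us]) /\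
  forall U, (U \in us ++ [seq u |: U | U <- us]) = (U \subset u |: X).
Proof.
move=> uus inX uX; have uU U : U \in us -> u \notin U.
  by rewrite inX => /subsetP s; apply: contra uX; apply: s.
split.
  rewrite cat_uniq uus /=; apply/andP; split.
    apply/hasPn => _ /mapP[U Uus ->]; apply/negP => /uU.
    by rewrite setU11.
  rewrite map_inj_in_uniq // => U W Uus Wus e.
  by rewrite -(setU1K (uU U Uus)) e setU1K // uU.
move=> U; rewrite mem_cat inX; case: (boolP (u \in U)) => uUU.
  have -> : (U \subset X) = false by apply: contraNF uX => /subsetP; apply.
  apply/mapP/idP => [[W Wus ->]|UX]; first by rewrite setUS // -inX.
  by exists (U :\ u); rewrite ?setD1K // inX subDset.
have -> : (U \in [seq u |: U | U <- us]) = false.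
  by apply: contraNF uUU => /mapP[W _ ->]; rewrite setU11.
rewrite orbF; apply/idP/idP => UX; first by rewrite (subset_trans UX) ?subsetUr.
apply/subsetP => w wU; have := subsetP UX w wU; rewrite !inE => /orP[/eqP e|//].
by rewrite -e wU in uUU.
Qed.

Lemma size_subsets (I : finType) (us : seq {set I}) (X : {set I}) :
  uniq us -> (forall U, (U \in us) = (U \subset X)) -> size us = 2 ^ #|X|.
Proof.
move=> uus inX; rewrite -card_powerset -(card_uniqP uus); apply: eq_card => U.
by rewrite inX powersetE.
Qed.

Lemma remove_vertex_does n (G : graph n) k d s (v : 'I_n) (D : {set 'I_n}) :
  env G k s -> reg s rV = v -> v \notin D -> #|nbh G v :\: D| <= d ->
  (forall u, u < n -> arr s aPow u = 2 ^ u) ->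
  (forall u : 'I_n, arr s aDead u = (u \in D)) ->
  (forall u : 'I_n, u \notin D -> arr s aDeg u = #|nbh G u :\: D|) ->
  does (remove_vertex d) s (100 + n * 13 + n * (200 + 2 ^ d * 100)) (fun s' =>
    same [:: 4; 7; 8; 9; 10] [:: aDeg; aDead; aCode; aLevel] s s' /\
    [/\ forall u : 'I_n, arr s' aDead u = (u \in v |: D),
        forall u : 'I_n, u \notin v |: D -> arr s' aDeg u = #|nbh G u :\: (v |: D)|
      & exists us, [/\ uniq us, forall U : {set 'I_n}, (U \in us) = (U \subset nbh G v :\: D)
          & lists d us s']]).
Proof.
move=> e rv vD vd pw dead deg; apply: does_same => //.
have [e0 e1 e2 e3 e4] := e.
set X := nbh G v :\: D.
(* The program marks [v] as removed before scanning its row; this is harmless, as [v] is not its own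
   neighbour. *)
have XD u : (u \in X) = (u \in nbh G v) && (u \notin v |: D).
  rewrite !inE; case: (eqVneq u v) => [->|_] /=; first by rewrite adj_irr andbF.
  by rewrite andbC.
apply: (does_le (T := 60 + n * 13 + (4 + n * (200 + 2 ^ d * 100)))).
  apply: does_le.
    apply: does_cat; apply: (does_mul (N := n)) => // [|s1 f1 m1 x1].
      by rewrite rv; apply: ltnW.
    apply: does_cat; apply: does_setarr; apply: does_cat; apply: does_setarr.
    apply: does_cat; apply: does_setarr; apply: does_cat; apply: does_set.
    set s2 := set_reg _ rLen _.
    have e' : env G k s2.
      apply: env_set => //; do 3 apply: env_setarr => //.
      split; rewrite ?f1 // => a; rewrite m1; exact: e4.
    have r0 : reg s2 rN = n by rewrite /= f1.
    have r8 : reg s2 rRow = v * n by rewrite /= x1 rv e0.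
    have a1 j x : j < 16 -> arr s1 j x = arr s j x by move=> _; apply: arr_ext; rewrite ?m1 ?f1.
    have ls : lists d [:: set0] s2.
      split=> // -[|//] _; rewrite arr_reg // !arr_set //= code0 cards0 subn0.
      by rewrite arr_reg // !arr_set.
    have dd (u : 'I_n) : arr s2 aDead u = (u \in v |: D).
      rewrite arr_reg // !arr_set //= f1 // rv !inE a1 // dead.
      by rewrite -(val_eqE u v); case: eqP.
    have dg (u : 'I_n) : u \notin D -> arr s2 aDeg u = #|nbh G u :\: D|.
      by move=> uD; rewrite arr_reg // !arr_set //= a1 // deg.
    have pw2 u : u < n -> arr s2 aPow u = 2 ^ u.
      by move=> un; rewrite arr_reg // !arr_set //= a1 // pw.
    (* Each round is charged with doubling a list of up to [2 ^ d] entries, which is coarse but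
       within the time bound. Degrees of vertices below j already refer to the enlarged removed set;
       for removed vertices they are left unspecified. *)
    apply: (does_loop (W := [:: 7; 9; 10]) (A := [:: aDeg; aCode; aLevel]) (N := n)
      (T := 194 + 2 ^ d * 100)
      (I := fun j s' =>
        (forall u : 'I_n, u \notin v |: D -> arr s' aDeg u =
           #|nbh G u :\: (if u < j then v |: D else D)|) /\
        exists us, [/\ uniq us, forall U : {set 'I_n}, (U \in us) = (U \subset prefix X j)
          & lists d us s'])) => //.
    - split=> [u|].
        by rewrite !inE negb_or => /andP[_ uD] /=; apply: dg.
      by exists [:: set0]; split=> // U; rewrite inE prefix0 subset0.
    - move=> j s' jn sm [dg' [us [uus inus [len ls']]]]; have [f a _] := sm.
      pose u := Ordinal jn; have uE : (u : nat) = j by [].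
      have es' : env G k s' by apply: env_same sm e'.
      have c := mem_row u es' (etrans (f rRow isT) r8).
      have xS := prefixS X u; rewrite uE XD in xS.
      have degN w : w \notin nbh G v -> nbh G w :\: (v |: D) = nbh G w :\: D.
        move=> wv; apply/setP => x; rewrite !inE; case: (eqVneq x v) => [->|] //.
        by move: wv; rewrite inE adj_sym => /negbTE ->; rewrite !andbF.
      have degS w : w \in nbh G v -> #|nbh G w :\: (v |: D)| = #|nbh G w :\: D| - 1.
        move=> wv; rewrite (cardsD1 v (_ :\: D)).
        have -> : v \in nbh G w :\: D by rewrite !inE vD adj_sym; rewrite inE in wv.
        rewrite add1n subn1 /=; apply: eq_card => x.
        by rewrite !inE negb_or andbA.
      have step w (b : nat) : w \notin v |: D ->
          b = (if w == u then if u \in nbh G v then arr s' aDeg w - 1 else arr s' aDeg w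
               else arr s' aDeg w) ->
          b = #|nbh G w :\: (if w < j.+1 then v |: D else D)|.
        move=> wD ->; rewrite dg' // ltnS [w <= j]leq_eqVlt.
        have -> : (w == j :> nat) = (w == u) by [].
        case: (eqVneq w u) => [->|] //=; rewrite ltnn.
        by case: ifP => h; [rewrite degS | rewrite degN ?h].
      apply: does_le.
        apply: does_cond => /=.
        + rewrite c => uv; have {}uv : u \in nbh G v by move: uv; case: (u \in _).
          apply: does_cat; apply: does_setarr => /=.
          set s3 := set_mem _ _ _.
          have ls3 : lists d us s3.
            by split=> // i iu; rewrite !arr_set //= !arr_reg //; apply: ls'.
          have dg3 (w : 'I_n) : w \notin v |: D -> arr s3 aDeg w =
              #|nbh G w :\: (if w < j.+1 then v |: D else D)|.
            move=> wD; apply: step => //; rewrite arr_set //= !arr_reg // uv.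
            by rewrite -(val_eqE w u) /=; case: eqP => // ->.
          have dead3 : arr s3 aDead u = (u \in v |: D).
            by rewrite arr_set //= arr_reg // a //; exact: (dd u).
          apply: (does_cond (T1 := 1) (T2 := 100 + 2 ^ d * 100)) => /= h.
            apply: does_nop; split=> //; exists us; split=> // U; rewrite inus xS.
            by move: h; rewrite dead3; case: (u \in _); rewrite ?andbF.
          have uD : u \notin v |: D by move: h; rewrite dead3; case: (u \in _).
          rewrite uv uD /= in xS.
          apply: does_weaken.
            apply: (double_list_does (u := u) ls3) => //.
            * by rewrite arr_set //= arr_reg // a // pw2.
            * move=> U; rewrite inus => /subsetP sU; apply: contra (prefix_notin X u).
              exact: sU.
            * rewrite (size_subsets uus inus) leq_exp2l // (leq_trans _ vd) //.
              by apply: subset_leq_card; apply/subsetP => w; rewrite inE => /andP[].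
          move=> s4 [[f4 a4 _] ls4]; split.
            by move=> w wD; rewrite a4 //; apply: dg3.
          exists (us ++ [seq u |: U | U <- us]).
          have [q1 q2] := subsets_double uus inus (prefix_notin X u).
          by split=> // U; rewrite q2 xS.
        + rewrite c => uv; have {}uv : (u \in nbh G v) = false by move: uv; case: (u \in _).
          apply: does_nop; split.
            move=> w wD; apply: step => //; rewrite arr_reg // uv.
            by case: ifP.
          by exists us; split=> // U; rewrite inus xS uv.
      by rewrite /=; lia.
    - move=> s' [f a _] [dg' [us [uus inus ls']]]; split.
      + by move=> u; rewrite a // dd.
      + by move=> u uD; rewrite dg' // ltn_ord.
      + by exists us; split=> // U; rewrite inus prefix_all.
  by rewrite /=; lia.
lia.
Qed.

Lemma test_vertex_does n d k (us : seq {set 'I_n}) (c : {set 'I_n} -> nat) s N :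
  lists d us s -> size us <= N ->
  (forall l, l <= d -> arr s aThr l = thr k d l) ->
  (forall U, arr s aCnt (code U) = c U) ->
  does test_vertex s (100 + N * 100) (fun s' => same [:: 10; 11] [::] s s' /\
    reg s' rAcc = all (fun U => c U < thr k d (d - #|U|)) us).
Proof.
move=> [len ls] usN th cn; apply: does_same => //.
apply: (does_le (T := 100 + size us * 100)); last by rewrite leq_add2l leq_mul2r usN orbT.
apply: does_le.
  apply: does_cat; apply: does_set.
  pose P := fun U : {set 'I_n} => c U < thr k d (d - #|U|).
  apply: (does_loop (W := [:: 10; 11]) (A := [::]) (N := size us)
    (I := fun j s' => reg s' rAcc = all P (take j us))) => //.
  - by rewrite take0.
  - move=> j s' jn [f a _] r11.
    have [c1 c2] := ls j jn.
    have Pj : P (nth set0 us j) = (eval (set_reg s' 10 j)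
       (Minus (Arr aThr (Arr aLevel (Var rI))) (Arr aCnt (Arr aCode (Var rI)))) != 0).
      rewrite /= !arr_reg // !a // !arr_reg // c1 c2 cn th ?leq_subr // subn_eq0.
      by rewrite -ltnNge.
    have tk : all P (take j.+1 us) = all P (take j us) && P (nth set0 us j).
      by rewrite (take_nth set0) // all_rcons andbC.
    apply: does_cond => h.
      by apply: does_nop; rewrite /= tk Pj h andbT.
    by apply: does_set; rewrite /= tk Pj h eqxx andbF.
  - by move=> s' _ ->; rewrite take_size.
by rewrite /=; lia.
Qed.

Lemma keep_vertex_does n d (us : seq {set 'I_n}) (c : {set 'I_n} -> nat) s N (b : bool)
    (v : 'I_n) (B : {set 'I_n}) :
  lists d us s -> size us <= N -> uniq us -> reg s rAcc = b -> reg s rV = v ->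
  (forall U, arr s aCnt (code U) = c U) ->
  (forall u : 'I_n, arr s aCore u = (u \in B)) ->
  does keep_vertex s (100 + N * 100) (fun s' => same [:: 10] [:: aCore; aCnt] s s' /\
    (forall U, arr s' aCnt (code U) = (b && (U \in us)) + c U) /\
    (forall u : 'I_n, arr s' aCore u = (u \in if b then v |: B else B))).
Proof.
move=> [len ls] usN uus r11 rv cn cr; apply: does_same => //.
apply: (does_le (T := 100 + size us * 100)); last by rewrite leq_add2l leq_mul2r usN orbT.
apply: does_le.
  apply: does_cond; rewrite /= r11 => hb; last first.
    by apply: does_nop; move: hb; case: b {r11} => // _; split.
  have {hb} -> : b = true by move: hb; case: b {r11}.
  apply: does_cat; apply: does_setarr => /=.
  apply: (does_loop (W := [:: 10]) (A := [:: aCnt]) (N := size us)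
    (I := fun j s' => forall U, arr s' aCnt (code U) = (U \in take j us) + c U)) => //.
  - by move=> U; rewrite take0 arr_set //= cn.
  - move=> j s' jn [f a _] ih; apply: does_setarr => /= U.
    have [c1 _] := ls j jn.
    rewrite arr_set //= !arr_reg // (a aCode) // arr_set //= c1.
    rewrite (inj_eq (@code_inj n)) ih ih (take_nth set0) // mem_rcons inE.
    case: eqP => [->|//] /=; rewrite addn1.
    (* The list has no repetitions, so no earlier round has raised this counter. *)
    suff -> : (nth set0 us j \in take j us) = false by [].
    apply/negP => h; have := uus; rewrite -(cat_take_drop j us) cat_uniq => /and3P[_ /hasPn h2 _].
    have /h2 : nth set0 us j \in drop j us by rewrite (drop_nth set0) // inE eqxx.
    by rewrite /= h.
  - move=> s' [f a _] ih; split=> [U|u].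
      by rewrite ih take_size.
    rewrite a // arr_set //= rv cr !inE.
    by have -> : (u == v :> nat) = (u == v) by []; case: eqP.
by rewrite /=; lia.
Qed.

(** * The loop that builds the core *)

Definition tables n d k (s : state) : Prop :=
  (forall u, u < n -> arr s aPow u = 2 ^ u) /\
  (forall l, l <= d -> arr s aThr l = thr k d l).

Definition core_rep n (G : graph n) (D B : {set 'I_n}) T (s : state) : Prop :=
  [/\ forall u : 'I_n, arr s aDead u = (u \in D),
      forall u : 'I_n, arr s aCore u = (u \in B),
      forall u : 'I_n, u \notin D -> arr s aDeg u = #|nbh G u :\: D|
    & forall U, arr s aCnt (code U) = cnt T B U].

(** The machine determines the elimination order, so only the size of [D] is tied to the round
    number. [T] is not kept in memory; it survives only through the counters. *)
Definition core_state n (G : graph n) d k t (s : state) : Prop :=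
  exists (D B : {set 'I_n}) T, [/\ #|D| = t, oriented G d D T, greedy_core d k D B T
    & core_rep G D B T s].

(** Degeneracy is applied to the subgraph induced on the vertices not yet removed. *)
Lemma degenerate_pick n (G : graph n) d (D : {set 'I_n}) :
  degenerate d G -> #|D| < n -> exists u, (u \notin D) && (#|nbh G u :\: D| <= d).
Proof.
move=> dg Dn; have [|||v] := dg (~: D) (fun u w => [&& u \in ~: D, w \in ~: D & adj G u w]).
- by rewrite -card_gt0 cardsCs setCK card_ord subn_gt0.
- by move=> u w; rewrite adj_sym andbCA.
- by [].
rewrite inE => vD vd; exists v; rewrite vD /=.
apply: leq_trans vd; apply: subset_leq_card; apply/subsetP => w.
by rewrite !inE vD.
Qed.

Lemma build_core_does n (G : graph n) k d s :
  degenerate d G -> env G k s -> tables n d k s -> core_state G d k 0 s ->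
  does (build_core d) s (10 + n * (1000 + n * 1000 + n * (2 ^ d * 1000) + 2 ^ d * 1000))
    (fun s' => same [:: 4; 5; 6; 7; 8; 9; 10; 11]
        [:: aDeg; aDead; aCore; aCnt; aCode; aLevel] s s' /\ core_state G d k n s').
Proof.
move=> dg e tb cs0; apply: does_same => //; apply: does_le.
  apply: (does_loop (W := [:: 4; 5; 6; 7; 8; 9; 10; 11])
    (A := [:: aDeg; aDead; aCore; aCnt; aCode; aLevel]) (N := n) (I := core_state G d k)) => //.
  - by case: e.
  - move=> j s' jn sm [D [B [T [cD or gc [dead core deg cn]]]]].
    have es' : env G k (set_reg s' 5 j) by apply: env_set => //; apply: env_same sm e.
    have [f a _] := sm; have [pw th] := tb; have [e0 _ _ _ _] := es'.
    apply: does_cat; apply: does_weaken.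
      apply: (pick_vertex_does (n := n) (d := d)
        (good := fun u => (u \notin D) && (#|nbh G u :\: D| <= d))) => //.
        move=> u; rewrite !arr_reg // dead addn_eq0 eqb0 subn_eq0.
        by case: (boolP (u \in D)) => uD //=; rewrite deg.
      by apply: degenerate_pick => //; rewrite cD.
    move=> s1 [sm1 [v rv /andP[vD vd]]]; have [f1 a1 _] := sm1.
    apply: does_cat; apply: does_weaken.
      apply: (remove_vertex_does (G := G) (k := k) (d := d) (v := v) (D := D)) => //.
      + exact: env_same sm1 es'.
      + by move=> u un; rewrite a1 // arr_reg // a // pw.
      + by move=> u; rewrite a1 // arr_reg.
      + by move=> u uD; rewrite a1 // arr_reg // deg.
    move=> s2 [[f2 a2 _] [dead2 deg2 [us [uus inus ls2]]]].
    have usN : size us <= 2 ^ d by rewrite (size_subsets uus inus) leq_exp2l.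
    have cn2 U : arr s2 aCnt (code U) = cnt T B U by rewrite a2 // a1 // arr_reg.
    apply: does_cat; apply: does_weaken.
      apply: (test_vertex_does (k := k) ls2 usN _ cn2).
      by move=> l ld; rewrite a2 // a1 // arr_reg // a // th.
    move=> s3 [[f3 a3 _] r11]; set b := all _ us in r11.
    have vB : v \notin B by case: gc => BD _ _; apply: contra vD; apply: subsetP.
    apply: does_weaken.
      apply: (keep_vertex_does (d := d) (us := us) (c := cnt T B) (N := 2 ^ d) (b := b)
        (v := v) (B := B)) => //.
      + by have [len ls] := ls2; split=> [|i iu]; rewrite ?f3 // !a3 //; apply: ls.
      + by rewrite f3 // f2.
      + by move=> U; rewrite a3.
      + by move=> u; rewrite a3 // a2 // a1 // arr_reg.
    move=> s4 [[f4 a4 _] [cn4 core4]].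
    exists (v |: D), (if b then v |: B else B), (orient_at G D T v); split.
    + by rewrite cardsU1 vD cD.
    + exact: oriented_step.
    (* If the test fails, the subset at which it fails is the witness that keeps [v] out of the
       core. *)
    + case: (boolP b) => [/allP hb|/allPn[U]]; last first.
        rewrite inus -leqNgt => UX; exact: greedy_core_skip.
      by apply: greedy_core_add => // U; rewrite -inus; apply: hb.
    + split=> //.
      * by move=> u; rewrite a4 // a3 // dead2.
      * by move=> u uD; rewrite a4 // a3 // deg2.
      * move=> U; rewrite cn4; case: b {r11 core4 cn4} => /=.
          by rewrite cntU1 // cnt_orient_at // inus /orient_at eqxx.
        by rewrite cnt_orient_at.
by rewrite /=; lia.
Qed.

(** * Choosing one vertex per trace *)

Lemma trace_code_does n (G : graph n) k (u : 'I_n) (B : {set 'I_n}) s :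
  env G k s -> reg s rRow = u * n ->
  (forall u, u < n -> arr s aPow u = 2 ^ u) ->
  (forall u : 'I_n, arr s aCore u = (u \in B)) ->
  does trace_code s (100 + n * 100) (fun s' => same [:: 7; 14] [::] s s' /\
    reg s' rCode = code (nbh G u :&: B)).
Proof.
move=> e r8 pw core; apply: does_same => //; have [e0 _ _ _ _] := e.
apply: does_le.
  apply: does_cat; apply: does_set.
  apply: (does_loop (W := [:: 7; 14]) (A := [::]) (N := n)
    (I := fun j s' => reg s' rCode = code (prefix (nbh G u :&: B) j))) => //.
  - by rewrite prefix0 code0.
  - move=> j s' jn sm r14; have [f a _] := sm; pose w := Ordinal jn.
    have es' : env G k s' by apply: env_same sm _ => //; apply: env_set.
    have c := mem_row w es' (etrans (f rRow isT) r8).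
    have := prefixS (nbh G u :&: B) w; rewrite in_setI /= => pS.
    have cw : arr (set_reg s' 7 j) aCore j = (w \in B).
      by rewrite arr_reg // a // arr_reg //; exact: (core w).
    apply: does_cond => /=.
      rewrite c => h; have {}h : w \in nbh G u by move: h; case: (w \in _).
      apply: does_cond => /=; rewrite cw => h'.
        have {}h' : w \in B by move: h'; case: (w \in B).
        apply: does_set => /=; rewrite pS h h' /= codeU1 ?prefix_notin // r14.
        by rewrite arr_reg // a // arr_reg // pw.
      have {}h' : (w \in B) = false by move: h'; case: (w \in B).
      by apply: does_nop; rewrite pS h h' /= r14.
    rewrite c => h; have {}h : (w \in nbh G u) = false by move: h; case: (w \in _).
    by apply: does_nop; rewrite pS h /= r14.
  - by move=> s' _ ->; rewrite prefix_all.
by rewrite /=; lia.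
Qed.

(** A core vertex is kept even when its trace has occurred before, so traces are claimed distinct
    only among kept vertices outside B. *)
Definition kept_list n (G : graph n) (B : {set 'I_n}) (ks : seq 'I_n) (j : nat) : Prop :=
  [/\ uniq ks,
      forall x, x \in ks -> x < j,
      forall x : 'I_n, x < j -> x \in B -> x \in ks,
      forall x : 'I_n, x < j -> x \notin ks ->
        exists2 y, y \in ks & nbh G x :&: B \subset nbh G y :&: B
    & {in ks &, forall x y, x \notin B -> y \notin B ->
        nbh G x :&: B = nbh G y :&: B -> x = y}].

Definition kept_rep n (x0 : 'I_n) (ks : seq 'I_n) (s : state) : Prop :=
  reg s rM = size ks /\ forall i, i < size ks -> arr s aKept i = nth x0 ks i.

Lemma kept_list_add n (G : graph n) (B : {set 'I_n}) ks (u : 'I_n) :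
  kept_list G B ks u ->
  (u \in B) || (nbh G u :&: B \notin [seq nbh G x :&: B | x <- ks]) ->
  kept_list G B (rcons ks u) u.+1.
Proof.
move=> [uks lt sB rp inj] ok.
have uk : u \notin ks by apply/negP => /lt; rewrite ltnn.
split.
- by rewrite rcons_uniq uk.
- by move=> x; rewrite mem_rcons inE => /orP[/eqP -> //|/lt]; apply: leqW.
- move=> x; rewrite ltnS leq_eqVlt mem_rcons inE => /orP[/eqP/val_inj -> _|xu xB].
    by rewrite eqxx.
  by rewrite sB ?orbT.
- move=> x; rewrite ltnS leq_eqVlt mem_rcons inE negb_or => xu /andP[ne xk].
  have {}xu : x < u by move: xu; rewrite (val_eqE x u) (negbTE ne).
  by have [y yk s] := rp x xu xk; exists y; rewrite // mem_rcons inE yk orbT.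
- have sep y : y \in ks -> u \notin B -> nbh G u :&: B <> nbh G y :&: B.
    move=> yk uB e; move: ok; rewrite (negbTE uB) /= e => /negP; apply.
    exact: map_f.
  move=> x y; rewrite !mem_rcons !inE => /orP[/eqP ->|xk] /orP[/eqP ->|yk] //.
  + by move=> uB _ /(sep y yk uB).
  + by move=> _ uB /esym/(sep x xk uB).
  + exact: inj.
Qed.

Lemma kept_list_skip n (G : graph n) (B : {set 'I_n}) ks (u : 'I_n) :
  kept_list G B ks u -> u \notin B ->
  nbh G u :&: B \in [seq nbh G x :&: B | x <- ks] -> kept_list G B ks u.+1.
Proof.
move=> [uks lt sB rp inj] uB dup.
have cases (x : 'I_n) : x < u.+1 -> x = u \/ x < u.
  by rewrite ltnS leq_eqVlt => /orP[/eqP/val_inj|]; [left|right].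
split=> //.
- by move=> x /lt; apply: leqW.
- by move=> x /cases[->|xu]; [rewrite (negbTE uB) | exact: sB].
- move=> x /cases[-> _|]; last exact: rp.
  by case/mapP: dup => y yk ->; exists y.
Qed.

Lemma choose_vertices_does n (G : graph n) k (B : {set 'I_n}) (x0 : 'I_n) s :
  env G k s -> (forall u, u < n -> arr s aPow u = 2 ^ u) ->
  (forall u : 'I_n, arr s aCore u = (u \in B)) -> (forall x, arr s aSeen x = 0) ->
  does choose_vertices s (100 + n * (300 + n * 100)) (fun s' =>
    same [:: 5; 7; 8; 13; 14] [:: aSeen; aKept] s s' /\
    exists ks, kept_list G B ks n /\ kept_rep x0 ks s').
Proof.
move=> e pw core seen; apply: does_same => //; have [e0 _ _ _ _] := e.
pose tr (x : 'I_n) := nbh G x :&: B.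
apply: does_le.
  apply: does_cat; apply: does_set; apply: does_cat; apply: does_set.
  apply: (does_loop (W := [:: 5; 7; 8; 13; 14]) (A := [:: aSeen; aKept]) (N := n)
    (I := fun j s' => reg s' rRow = j * n /\ exists ks : seq 'I_n,
      [/\ kept_list G B ks j, kept_rep x0 ks s' &
          forall U, arr s' aSeen (code U) = (U \in map tr ks)])) => //.
  - by split=> //; exists [::]; split=> // U; rewrite !arr_reg // seen.
  - move=> j s' jn sm [r8 [ks [kl [r13 kr] sn]]]; have [f a _] := sm.
    pose u := Ordinal jn.
    have es' : env G k (set_reg s' 5 j).
      by apply: env_set => //; apply: env_same sm _ => //; do 2 apply: env_set => //.
    apply: does_cat; apply: does_weaken.
      apply: (trace_code_does (u := u) (B := B) es') => //.
        by move=> w wn; rewrite arr_reg // a // !arr_reg // pw.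
      by move=> w; rewrite arr_reg // a // !arr_reg.
    move=> s1 [[f1 a1 _] r14].
    have core1 : arr s1 aCore j = (u \in B).
      by rewrite a1 // arr_reg // a // !arr_reg //; exact: (core u).
    have sn1 U : arr s1 aSeen (code U) = (U \in map tr ks).
      by rewrite a1 // arr_reg.
    have kr1 i : i < size ks -> arr s1 aKept i = nth x0 ks i.
      by move=> ik; rewrite a1 // arr_reg // kr.
    have r5 : reg s1 5 = j by rewrite f1.
    have ev : eval s1 (Minus (Arr aSeen (Var rCode)) (Arr aCore (Var rT))) =
        (tr u \in map tr ks) - (u \in B).
      by rewrite /= r14 r5 core1 sn1.
    apply: does_cat; apply: does_cond; rewrite ev => h.
      apply: does_nop; apply: does_set.
      split; first by rewrite /= (f1 rRow) //= (f1 rN) //= r8 (f rN) //= e0 mulSn addnC.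
      have uB : u \notin B by move: h; case: (u \in B) => //; case: (_ \in _).
      have dup : tr u \in map tr ks by move: h; case: (_ \in map _ _).
      exists ks; split=> //; first exact: (kept_list_skip (u := u)).
        by split=> [|i ik]; rewrite /= ?f1 // ?arr_reg // kr1.
    apply: does_cat; apply: does_setarr; apply: does_cat; apply: does_set.
    apply: does_setarr; apply: does_set.
    split; first by rewrite /= (f1 rRow) //= (f1 rN) //= r8 (f rN) //= e0 mulSn addnC.
    have ok : (u \in B) || (tr u \notin map tr ks).
      by move: h; case: (u \in B) => //; case: (_ \in map _ _).
    exists (rcons ks u); split=> //; first exact: (kept_list_add (u := u)).
      split=> [|i]; first by rewrite /= f1 //= r13 size_rcons addn1.
      rewrite size_rcons ltnS => ik.
      rewrite arr_reg // arr_set //= ?f1 //= arr_reg // arr_set //= ?f1 //.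
      rewrite r13 nth_rcons.
      by case: (ltngtP i (size ks)) ik => // ik _; exact: kr1.
    move=> U; rewrite arr_reg // arr_set //= arr_reg // arr_set //=.
    rewrite r14 (inj_eq (@code_inj n)) map_rcons mem_rcons inE.
    by case: eqP => // _; exact: sn1.
  - by move=> s' _ [_ [ks [? ? _]]]; exists ks.
by rewrite /=; lia.
Qed.

(** * Writing the output matrix *)

Definition out_state n (G : graph n) k (B : {set 'I_n}) (ks : seq 'I_n) (x0 : 'I_n)
    (f : nat -> nat -> bool) (s : state) : Prop :=
  let m := size ks in
  [/\ [/\ reg s rN = n, reg s rK = k, reg s rOut = n * n &
          reg s rBase = n * n + (n + 2) * (n + 2)],
      [/\ reg s rM = m, reg s rSize = m.+2 & reg s rApexRow = n * n + m * m.+2],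
      [/\ forall i, i < m -> arr s aKept i = nth x0 ks i,
          forall u : 'I_n, arr s aCore u = (u \in B)
        & forall u v : 'I_n, mem s (u * n + v) = adj G u v]
    & forall r c, r < m.+2 -> c < m.+2 -> mem s (n * n + (r * m.+2 + c)) = f r c].

Lemma out_state_reg n (G : graph n) k B ks x0 f s r v :
  r \notin [:: 0; 1; 2; 3; 13; 15; 17] -> out_state G k B ks x0 f s ->
  out_state G k B ks x0 f (set_reg s r v).
Proof.
rewrite !inE !negb_or !(eq_sym r).
move=> /and5P[/negbTE h0 /negbTE h1 /negbTE h2 /negbTE h3 /and3P[/negbTE h4 /negbTE h5 /negbTE h6]].
move=> [[a1 a2 a3 a4] [b1 b2 b3] [c1 c2 c3] cells].
by split=> //; [split; rewrite /= ?h0 ?h1 ?h2 ?h3 | split; rewrite /= ?h4 ?h5 ?h6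
  | split=> // [i im|u]; rewrite arr_reg ?c1 // eq_sym h3].
Qed.

Lemma out_state_ext n (G : graph n) k B ks x0 f g s :
  (forall r c, r < (size ks).+2 -> c < (size ks).+2 -> f r c = g r c) ->
  out_state G k B ks x0 f s -> out_state G k B ks x0 g s.
Proof. by move=> fg [a b c d]; split=> // r c' hr hc; rewrite d // fg. Qed.

(** Output cells are addressed directly, so the frame for arrays does not apply. As [size ks <= n],
    the cell lies in the reserved block, past the input and before the arrays; division by the row
    length recovers its row and column. *)
Lemma out_state_set n (G : graph n) k B ks x0 f s r0 c0 a (b : bool) :
  size ks <= n -> r0 < (size ks).+2 -> c0 < (size ks).+2 ->
  a = n * n + (r0 * (size ks).+2 + c0) ->
  out_state G k B ks x0 f s ->
  out_state G k B ks x0 (fun r c => if (r == r0) && (c == c0) then b else f r c)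
    (set_mem s a b).
Proof.
set m := size ks => mn hr hc -> [[a1 a2 a3 a4] [b1 b2 b3] [c1 c2 c3] cells].
have inside : r0 * m.+2 + c0 < (n + 2) * (n + 2) by nia.
have far j x : arr (set_mem s (n * n + (r0 * m.+2 + c0)) b) j x = arr s j x.
  by rewrite /arr /= a4; case: eqP => //; lia.
split=> //; first split=> // [i im|u|u v]; rewrite ?far ?c1 //=.
  have lt : u * n + v < n * n by have := ltn_ord u; have := ltn_ord v; nia.
  by case: eqP => [|_]; [lia | exact: c3].
move=> r c rm cm /=; rewrite eqn_add2l.
have -> : (r * m.+2 + c == r0 * m.+2 + c0) = (r == r0) && (c == c0).
  apply/eqP/andP => [e|[/eqP-> /eqP->]] //.
  have er : r = r0 by have := congr1 (divn^~ m.+2) e; rewrite !divnMDl // !divn_small // !addn0.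
  by move: e; rewrite er => /addnI ->; rewrite !eqxx.
by case: ifP => // _; exact: cells.
Qed.

(** Row [m] is the apex row, which gains one entry per round. Unwritten cells hold 0, so the
    conjunction with [kernel_adj] describes the whole block at every round. *)
Definition rows_done (m i r c : nat) : bool := (r < i) || (r == m) && (c < i).

Lemma output_row_does n (G : graph n) k (B : {set 'I_n}) ks x0 i s :
  size ks <= n -> i < size ks ->
  out_state G k B ks x0 (fun r c => rows_done (size ks) i r c && kernel_adj G B ks x0 r c) s ->
  reg s rT = i -> reg s rOutRow = n * n + i * (size ks).+2 ->
  does output_row s (100 + n * 100) (fun s' =>
    out_state G k B ks x0
      (fun r c => rows_done (size ks) i.+1 r c && kernel_adj G B ks x0 r c) s' /\
    reg s' rOutRow = n * n + i.+1 * (size ks).+2).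
Proof.
set m := size ks => mn im os r5 r16; pose v := nth x0 ks i.
pose K := kernel_adj G B ks x0.
have Kij j : j < m -> K i j = adj G v (nth x0 ks j).
  by move=> jm; rewrite /K /kernel_adj -/m im jm.
have Kim : K i m = (v \notin B) by rewrite /K /kernel_adj -/m im ltnn eqxx.
have Kmi : K m i = (v \notin B) by rewrite /K /kernel_adj -/m ltnn eqxx im.
have Kim1 : K i m.+1 = false by rewrite /K /kernel_adj -/m im ltnNge leqnSn /= gtn_eqF.
have [_ _ [kr _ _] _] := os.
apply: (does_le (T := 70 + n * 13 + m * 40)); last by lia.
apply: does_le.
  apply: does_cat; apply: does_set; rewrite /= r5 (kr i im).
  apply: does_cat; apply: (does_mul (N := n)) => // [|s1 f1 m1 x1].
    by rewrite /=; apply: ltnW.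
  have os1 : out_state G k B ks x0 (fun r c => rows_done m i r c && K r c) s1.
    have ar j x : arr s1 j x = arr s j x by apply: arr_ext; rewrite ?m1 ?f1.
    case: os => [[a1 a2 a3 a4] [b1 b2 b3] [c1 c2 c3] cells].
    by split; first [split | move=> r c hr hc]; rewrite ?m1 ?f1 // => *; rewrite ?ar ?m1 ?c1 ?cells.
  have r8 : reg s1 rRow = v * n by rewrite x1 /=; case: os => [[-> _ _ _] _ _ _].
  apply: does_cat; apply: (does_loop_reg (W := [:: 7]) (N := m)
    (I := fun j s' => out_state G k B ks x0
       (fun r c => (rows_done m i r c || (r == i) && (c < j)) && K r c) s')) => //.
  - by case: os1 => _ [].
  - by apply: out_state_ext os1 => r c _ _; rewrite andbF orbF.
  - move=> j s' jm f' os'; apply: does_setmem => /=.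
    have [_ _ [kr' _ inp'] _] := os'.
    rewrite arr_reg // kr' // !f' // r8 inp' (f1 rOutRow) //= r16 -Kij //.
    apply: out_state_ext (out_state_set (r0 := i) (c0 := j) (K i j) mn _ _ _
      (out_state_reg (r := 7) _ _ os')) => //; last 1 [lia | lia | lia].
    move=> r c rm cm; rewrite ltnS [c <= j]leq_eqVlt.
    case: (eqVneq r i) => [->|] //=; case: (eqVneq c j) => [->|] //=.
    by rewrite orbT.
  move=> s2 f2 os2; have [[g0 g1 g2 g3] [h1 h2 h3] [_ cr2 _] _] := os2.
  have r6 : reg s2 rV = v by rewrite f2 // f1.
  have r5' : reg s2 rT = i by rewrite f2 // f1.
  have r16' : reg s2 rOutRow = n * n + i * m.+2 by rewrite f2 // f1.
  have nB : 1 - arr s2 aCore v = (v \notin B) by rewrite cr2; case: (v \in B).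
  apply: does_cat; apply: does_setmem; rewrite /= r16' h1 r6 nB.
  set s3 := set_mem _ _ _.
  (* Row i is now complete: its entry in the pendant column is 0 and needs no write. *)
  have os3 : out_state G k B ks x0 (fun r c => (rows_done m i r c || (r == i)) && K r c) s3.
    apply: out_state_ext (out_state_set (r0 := i) (c0 := m) _ mn _ _ _ os2) => //; [|lia..].
    move=> r c rm cm; case: (eqVneq r i) => [->|] //=.
    case: (eqVneq c m) => [->|cm'] /=; first by rewrite orbT Kim.
    case: (ltnP c m) => // hc.
    have -> : c = m.+1 by lia.
    by rewrite Kim1 !andbF.
  have nB3 : 1 - arr s3 aCore v = (v \notin B) by case: os3 => _ _ [_ -> _] _; case: (v \in B).
  apply: does_cat; apply: does_setmem; rewrite /= h3 r5' r6 nB3.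
  set s4 := set_mem _ _ _; apply: does_set; rewrite /= r16' h2; split; last by lia.
  apply: out_state_reg => //; rewrite /s4.
  apply: out_state_ext (out_state_set (r0 := m) (c0 := i) _ mn _ _ _ os3) => //; [|lia..].
  move=> r c rm cm; rewrite /rows_done !ltnS [r <= i]leq_eqVlt [c <= i]leq_eqVlt.
  case: (eqVneq r m) => [->|] /=; last by rewrite !orbF orbC.
  by case: (eqVneq c i) => [->|] /=; rewrite ?orbT // (gtn_eqF im) /= ?orbF.
by rewrite /=; lia.
Qed.

Lemma output_does n (G : graph n) k (B : {set 'I_n}) ks x0 s :
  size ks <= n -> env G k s -> kept_rep x0 ks s ->
  (forall u : 'I_n, arr s aCore u = (u \in B)) ->
  does output s (200 + n * (200 + n * 100)) (fun s' =>
    holds_instance s' (kernel_graph G B ks x0) k.+1).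
Proof.
set m := size ks => mn e [r13 kr] cr; have [e0 e1 e2 e3 e4] := e.
pose K := kernel_adj G B ks x0.
apply: (does_le (T := 100 + n * 13 + m * (120 + n * 100))); last by nia.
apply: does_le.
  apply: does_cat; apply: does_set.
  apply: does_cat; apply: (does_mul (N := n)) => // [|s1 f1 m1 x1].
    by rewrite /= r13.
  apply: does_cat; apply: does_set; apply: does_cat; apply: does_set.
  set s2 := set_reg _ rOutRow _.
  have os : out_state G k B ks x0 (fun r c => rows_done m 0 r c && K r c) s2.
    have ar j x : arr s1 j x = arr s j x by apply: arr_ext; rewrite ?m1 ?f1.
    split.
    - by split; rewrite /= f1.
    - split; rewrite /= ?(f1 rM) ?(f1 rSize) ?(f1 rOut) //= ?r13 ?addn2 //.
      by rewrite e2 x1 /= r13 addn2.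
    - split=> [i im|u|u v].
      + by rewrite !arr_reg // ar kr.
      + by rewrite !arr_reg // ar cr.
      + by rewrite /= m1 /= (env_adj _ _ e).
    - move=> r c hr hc; rewrite /= m1 /= e4.
        by rewrite input_zero ?leq_addr // /rows_done !ltn0 andbF.
      by rewrite e3 ltn_add2l; move: hr hc mn; rewrite -/m; nia.
  apply: does_cat; apply: (does_loop_reg (W := [:: 4; 5; 6; 7; 8; 16]) (N := m)
    (I := fun j s' => out_state G k B ks x0 (fun r c => rows_done m j r c && K r c) s' /\
                      reg s' rOutRow = n * n + j * m.+2)) => //.
  - by case: os => _ [].
  - by split=> //=; rewrite f1 //= e2 addn0.
  - move=> j s' jm f' [os' r16]; exact: output_row_does.
  move=> s3 f3 [os3 r16]; have [_ [h1 h2 h3] _ _] := os3.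
  apply: does_cat; apply: does_setmem => /=; set s4 := set_mem _ _ _.
  have os4 : out_state G k B ks x0 (fun r c => if (r == m) && (c == m.+1) then true
      else rows_done m m r c && K r c) s4.
    by apply: out_state_set os3; rewrite ?h1 ?h3 -/m //; lia.
  apply: does_cat; apply: does_setmem => /=; rewrite h1 h2 h3; set s5 := set_mem _ _ _.
  have os5 : out_state G k B ks x0 K s5.
    apply: out_state_ext (out_state_set (r0 := m.+1) (c0 := m) true mn _ _ _ os4) => //; [|lia..].
    move=> r c hr hc; rewrite /K /kernel_adj /rows_done -/m.
    case: (ltngtP r m) => hrm; rewrite ?andbF ?andbT ?orbF //=.
    - by have -> : (r == m.+1) = false by lia.
    - have -> : r = m.+1 by move: hr; rewrite -/m; lia.
      by rewrite eqxx /=; case: (c == m).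
    - have -> : (r == m.+1) = false by lia.
      case: (ltnP c m) => hcm /=; last by case: (c == m.+1).
      by have -> : (c == m.+1) = false by lia.
  clearbody s5; apply: does_cat; apply: does_set; apply: does_set.
  have [[g0 g1 g2 g3] [k1 k2 k3] _ cells] := os5.
  split; first exact: k2.
    by rewrite /= g1 addn1.
  move=> u v; rewrite -[reg _ rOut]/(reg s5 rOut) g2.
  exact: (cells u v (ltn_ord u) (ltn_ord v)).
by rewrite /=; lia.
Qed.

(** * Assembly of the program and numerical bounds *)

Lemma initial_core n (G : graph n) d k s :
  (forall u : 'I_n, arr s aDeg u = #|nbh G u|) ->
  (forall j x, j \in [:: aDead; aCore; aCnt] -> arr s j x = 0) -> core_state G d k 0 s.
Proof.
move=> dg z; have c0 U : cnt (fun _ => set0) (@set0 'I_n) U = 0.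
  by apply/eqP; rewrite cards_eq0; apply/eqP/setP => b; rewrite !inE.
exists set0, set0, (fun _ => set0); split.
- exact: cards0.
- by move=> u; rewrite inE.
- by split=> [|U _|w]; rewrite ?inE ?c0.
- split=> [u|u|u _|U]; first by rewrite z // inE.
  + by rewrite z // inE.
  + by rewrite dg setD0.
  + by rewrite z // c0.
Qed.

Lemma kernelize_does n (G : graph n) k d : degenerate d G -> 0 < k -> k < n ->
  does (kernelize d) (input_state G k)
    (1000 + n * 2000 + n * n * 1500 + d * 100 + d * n * 100 +
     n * n * 2 ^ d * 1000 + n * 2 ^ d * 1000)
    (fun s => exists (B : {set 'I_n}) T ks x0,
      [/\ oriented G d setT T, greedy_core d k setT B T, kept_list G B ks n &
          holds_instance s (kernel_graph G B ks x0) k.+1]).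
Proof.
move=> dg k0 kn; pose x0 : 'I_n := Ordinal (leq_ltn_trans (leq0n k) kn).
apply: does_le.
  apply: (does_cond (T2 := 0)) => /= h; last by exfalso; lia.
  apply: does_cat; apply: does_weaken; first exact: layout_does.
  move=> s1 [e z]; have [e0 _ _ _ _] := e.
  apply: does_cat; apply: does_weaken; first exact: (powers_does (n := n)).
  move=> s2 [sm2 pw]; have es2 : env G k s2 by apply: env_same sm2 e.
  have [f2 a2 _] := sm2.
  apply: does_cat; apply: does_weaken; first exact: (thresholds_does d es2 (ltnW kn)).
  move=> s3 [sm3 th]; have es3 : env G k s3 by apply: env_same sm3 es2.
  have [f3 a3 _] := sm3.
  apply: does_cat; apply: does_weaken; first exact: (degrees_does es3).
  move=> s4 [sm4 deg]; have es4 : env G k s4 by apply: env_same sm4 es3.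
  have [f4 a4 _] := sm4.
  apply: does_cat; apply: does_weaken.
    apply: (build_core_does dg es4).
    - split=> [u un|l ld]; first by rewrite a4 // a3 // pw.
      by rewrite a4 // th.
    - apply: initial_core => // j x; rewrite !inE => /or3P[] /eqP ->;
        by rewrite a4 // a3 // a2.
  move=> s5 [sm5 [D [B [T [cD or gc [_ core _ _]]]]]].
  have es5 : env G k s5 by apply: env_same sm5 es4.
  have [f5 a5 _] := sm5.
  have DT : D = setT by apply/eqP; rewrite eqEcard subsetT cardsT card_ord cD leqnn.
  rewrite DT in or gc.
  apply: does_cat; apply: does_weaken.
    apply: (choose_vertices_does (B := B) x0 es5) => //.
    - by move=> u un; rewrite a5 // a4 // a3 // pw.
    - by move=> x; rewrite a5 // a4 // a3 // a2.
  move=> s6 [sm6 [ks [kl kr]]]; have es6 : env G k s6 by apply: env_same sm6 es5.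
  have [f6 a6 _] := sm6.
  apply: does_weaken.
    apply: (output_does (B := B) _ es6 kr); last by move=> u; rewrite a6.
    have [uks _ _ _ _] := kl; rewrite -(card_uniqP uks) -[leqRHS]card_ord.
    exact: max_card.
  by move=> s7 hi; exists B, T, ks, x0.
by rewrite /=; move: (2 ^ d) => E; nia.
Qed.

Lemma kernelize_small d n (G : graph n) k : n <= k ->
  does (kernelize d) (input_state G k) 7 (fun s => s = input_state G k).
Proof.
move=> nk; apply: does_le.
  apply: (does_cond (T1 := 0)) => /= h; last exact: does_nop.
  by exfalso; lia.
by [].
Qed.

(** The left side bounds vertices and edges alike. Multiplying out, the two terms in b are each at
    most X, the second because [b + 1] is at most [(d + 2) ^ 2 * k ^ (d + 1)], and the two extra
    vertices contribute at most 2 X; hence the factor 4. *)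
Lemma vertex_bound d k b m : 0 < d -> 0 < k ->
  b <= (d + 2) * (d + 1) * k ^ (d + 1) -> m <= b * (d + 1) + (b + 1) ^ d ->
  m.+2 * (d + 1) <= 4 * ((d + 2) ^ (2 * (d + 2)) * k ^ (2 * (d + 1) ^ 2)).
Proof.
move=> d0 k0 hb hm; set X := _ * k ^ _.
have le i j : i <= 2 * (d + 2) -> j <= 2 * (d + 1) ^ 2 -> (d + 2) ^ i * k ^ j <= X.
  by move=> hi hj; apply: leq_mul; rewrite leq_pexp2l //; lia.
have x1 : (d + 2) ^ 1 * k ^ 0 <= X by apply: le; nia.
have x2 : (d + 2) ^ 4 * k ^ (d + 1) <= X by apply: le; nia.
have x3 : (d + 2) ^ (2 * d).+1 * k ^ ((d + 1) * d) <= X by apply: le; nia.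
set K := k ^ (d + 1) in hb x2.
have K0 : 0 < K by rewrite expn_gt0 k0.
have b2 : b * (d + 1) * (d + 1) <= X.
  apply: leq_trans x2; rewrite (expnS _ 3) (expnS _ 2) -mulnn; nia.
have b3 : (b + 1) ^ d * (d + 1) <= X.
  apply: leq_trans x3; rewrite expnS expnM expnM -/K -mulnA mulnC -expnMn leq_mul //; first by lia.
  by rewrite leq_exp2r // -mulnn; nia.
rewrite expn1 expn0 muln1 in x1.
apply: (@leq_trans ((b * (d + 1) + (b + 1) ^ d + 2) * (d + 1))); first by rewrite leq_mul2r; lia.
by rewrite !mulnDl; lia.
Qed.

(** As [2 <= 2 ^ d], the terms without the factor [2 ^ d] are at most half their coefficient times
    the target, and the total stays below 4900. *)
Lemma time_bound d n : 0 < d -> 0 < n ->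
  1000 + n * 2000 + n * n * 1500 + d * 100 + d * n * 100 +
     n * n * 2 ^ d * 1000 + n * 2 ^ d * 1000 <= 4900 * (2 ^ d * d * n ^ 2).
Proof.
move=> d0 n0; have E0 : 2 ^ 1 <= 2 ^ d by rewrite leq_exp2l.
rewrite expn1 in E0.
rewrite -mulnn; move: (2 ^ d) E0 => E E0.
have h1 : n * n * E <= E * d * (n * n) by nia.
have h2 : n * n * 2 <= n * n * E by rewrite leq_mul2l E0 orbT.
have h3 : 2 * (d * (n * n)) <= E * d * (n * n) by rewrite mulnA !leq_mul2r E0 !orbT.
have h4 : n * E <= n * n * E by rewrite leq_mul2r leq_pmulr ?orbT.
have h5 : d * n <= d * (n * n) by rewrite leq_mul2l leq_pmulr ?orbT.
have h6 : n <= n * n by rewrite leq_pmulr.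
have h7 : d <= d * n by rewrite leq_pmulr.
lia.
Qed.

Theorem theorem2 :
  exists C : nat, forall d : nat, 1 <= d ->
  exists p : prog,
    kernelization (@degenerate d) p
      (fun k => C * ((d + 2) ^ (2 * (d + 2)) * k ^ (2 * (d + 1) ^ 2)))
      (fun n => C * (2 ^ d * d * n ^ 2)).
Proof.
(* The time constant also covers the size constant 4. The program uses registers 0 to 17, so scratch
   starts at 18, and the new parameter is k or [k.+1]. *)
exists 4900 => d d1; exists (compile (kernelize d) 18); exists succn => n G k dg k0.
have [|s [t [ex tc [sr sm] _]]] :=
    @compile_ok (kernelize d) 18 18 (input_state G k) (input_state G k) isT isT isT.
  by [].
case: (ltnP k n) => kn; last first.
  have [rn tm] := kernelize_small d G kn.
  rewrite rn in sr sm.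
  (* The unchanged instance has at most [n * n], hence at most [k ^ 2], edges. *)
  have X1 : k ^ 2 <= (d + 2) ^ (2 * (d + 2)) * k ^ (2 * (d + 1) ^ 2).
    apply: leq_trans (leq_pmull _ _); last by rewrite expn_gt0; lia.
    by rewrite leq_pexp2l //; nia.
  have eG : #|edges G| <= n * n.
    apply: (card_edges_le (T := nbh G)) => [u v uv|u]; first by left; rewrite inE.
    by rewrite -[leqRHS]card_ord max_card.
  exists t, s, n, G, k; split=> //.
  - split=> // n0; apply: leq_trans tc (leq_trans tm _).
    by apply: (@leq_trans 4900); rewrite // leq_pmulr // !muln_gt0 !expn_gt0 n0 d1.
  - have [h0 h1 h2] := holds_input G k; split=> //; split=> [||u v].
    + by rewrite sr.
    + by rewrite sr.
    + by rewrite sr // sm h2.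
  - have {}X1 := leq_trans X1 (leq_pmull _ (isT : 0 < 4900)).
    split; apply: leq_trans _ X1; first by apply: leq_trans kn _; rewrite -mulnn leq_pmulr.
    by apply: leq_trans eG _; rewrite -mulnn leq_mul.
have [[B [T [ks [x0 [or gc kl hi]]]]] tm] := kernelize_does dg k0 kn.
have [uks _ sB rp inj] := kl.
have hb := core_size k0 gc; have hm := kernel_size or uks inj.
have X := vertex_bound d1 k0 hb hm.
have he := kernel_edges B x0 or uks.
exists t, s, (size ks).+2, (kernel_graph G B ks x0), k.+1; split=> //.
- split=> // n0; apply: leq_trans tc (leq_trans tm _); exact: time_bound.
- have [h0 h1 h2] := hi; split=> //; split=> [||u v].
  + by rewrite sr.
  + by rewrite sr.
  + by rewrite sr // sm h2.
- have {}X := leq_trans X (leq_mul (isT : 4 <= 4900) (leqnn _)).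
  by split; [apply: leq_trans X; rewrite leq_pmulr ?addn1 | exact: leq_trans he X].
- apply: kernel_equiv => //.
  + by move=> x xB; apply: sB.
  + by move=> x xk; apply: rp.
  + by move=> S Sk; apply: core_dominates or gc Sk.
Qed.
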